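(* For any $h\in H$ and any $x\in\sum_{v\in\mathcal{V}}(\delta_v-2)E_v^*+\operatorname{int}(\mathcal{S}')$ we have $$Q_h^{red}(x)=\sum_{v\in\mathcal{N}}\mathrm{Coeff}\Big(\mathrm{T}\Big[t_v^{-r_{h-[x]}}f_h(t_v)\frac{t_v}{1-t_v}\Big],t_v^{x}\Big)-\sum_{\overline{vw}\text{ edge of }\mathcal{T}^{orb}}\mathrm{Coeff}\Big(\mathrm{T}\Big[\mathbf{t}_{vw}^{-r_{h-[x]}}f_h(\mathbf{t}_{vw})\frac{t_vt_w}{(1-t_v)(1-t_w)}\Big],\mathbf{t}_{vw}^{x}\Big),$$ where $\mathcal{T}^{orb}$ is the orbifold graph of $\mathcal{T}$.
   Context: $\mathcal{T}$ is a finite tree (a connected negative definite plumbing graph with all genera zero) with vertex set $\mathcal{V}$; $\delta_v$ is the valency of $v$; $\mathcal{N}=\{v\in\mathcal{V}:\delta_v\ge3\}$ is the set of nodes. The orbifold graph $\mathcal{T}^{orb}$ has vertex set $\mathcal{N}$, two nodes being joined by an edge if they are connected in $\mathcal{T}$ by a path all of whose vertices other than the two nodes have valency $2$. $L=\mathbb{Z}\langle E_v\rangle_{v\in\mathcal{V}}$ is a free lattice with a negative definite integral symmetric form $(\,,\,)$ such that, for $v\ne w$, $(E_v,E_w)=1$ if $\overline{vw}$ is an edge of $\mathcal{T}$ and $0$ otherwise. $L'\subset L\otimes\mathbb{Q}$ is the dual lattice, freely generated by the elements $E_v^*$ defined by $(E_v^*,E_w)=-1$ if $v=w$ and $0$ otherwise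 (all coordinates of $E_v^*$ in the basis $\{E_w\}$ are positive). $H=L'/L$ is a finite group; $[x]\in H$ is the class of $x\in L'$. For $g\in H$, $r_g$ is the unique element of $L'\cap\sum_{v}[0,1)E_v$ with $[r_g]=g$. $\mathcal{S}'=\mathbb{Z}_{\ge0}\langle E_v^*\rangle_{v}$ and $\operatorname{int}(\mathcal{S}')=\mathbb{Z}_{>0}\langle E_v^*\rangle_{v}$. For $y=\sum_v y_vE_v\in L'$ and $\emptyset\ne\mathcal{I}\subseteq\mathcal{V}$ put $\mathbf{t}^y=\prod_{v\in\mathcal V} t_v^{y_v}$, $\mathbf{t}_{\mathcal{I}}^{y}=\prod_{v\in\mathcal{I}}t_v^{y_v}$; for $\mathcal{I}=\{v\}$ write $t_v^y=t_v^{y_v}$, and $\mathbf{t}_{vw}=\mathbf{t}_{\{v,w\}}$. Define $f_h$ by $\prod_{v\in\mathcal{V}}(1-[E_v^*]\mathbf{t}^{E_v^*})^{\delta_v-2}=\sum_{h\in H}f_h(\mathbf{t})\cdot h$ (coefficients in $\mathbb{Z}[H]$), and let $f_h(\mathbf{t}_{\mathcal{I}})$ be $f_h(\mathbf{t})$ with $t_v=1$ for $v\notin\mathcal{I}$. $\mathrm{T}[\,\cdot\,]$ is Taylor expansion at the origin (monomial prefactors shift the series) and $\mathrm{Coeff}(S,\mathbf{t}_{\mathcal{I}}^{x})$ is the coefficient of $\mathbf{t}_{\mathcal{I}}^x$ in $S$. If $\sum_{l'}p_{l'}\mathbf{t}^{l'}=\mathrm{T}[\prod_v(1-\mathbf{t}^{E_v^*})^{\delta_v-2}]$,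 then $\mathrm{T}[f_h(\mathbf{t}_{\mathcal{I}})]=\sum_{[l']=h}p_{l'}\mathbf{t}_{\mathcal{I}}^{l'}$. $Q_h^{red}$ is the counting function of the reduced series $Z_h(\mathbf{t}_{\mathcal{N}})=\mathrm{T}[f_h(\mathbf{t}_{\mathcal{N}})]$, i.e. $Q_h^{red}(x)$ is the (finite) sum of $p_{l'}$ over $l'\in L'$ with $[l']=h$ and $l'_v<x_v$ for at least one $v\in\mathcal{N}$; equivalently $$Q_h^{red}(x)=\sum_{\emptyset\ne\mathcal{I}\subseteq\mathcal{N}}(-1)^{|\mathcal{I}|-1}\mathrm{Coeff}\Big(\mathrm{T}\Big[\mathbf{t}_{\mathcal{I}}^{-r_{h-[x]}}f_h(\mathbf{t}_{\mathcal{I}})\prod_{i\in\mathcal{I}}\frac{\mathbf{t}_{\mathcal{I}}^{E_i}}{1-\mathbf{t}_{\mathcal{I}}^{E_i}}\Big],\mathbf{t}_{\mathcal{I}}^{x}\Big).$$ *)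

(* Defs.v *)
From HB Require Import structures.
From mathcomp Require Import all_boot all_order all_algebra.
From mathcomp Require Import boolp classical_sets fsbigop.

Set Implicit Arguments.
Unset Strict Implicit.
Unset Printing Implicit Defensive.

Import Order.TTheory GRing.Theory Num.Theory.
Local Open Scope ring_scope.

(* L (x) Q, an element x being the coordinate function v |-> x_v in the basis
   (E_v). *)
Notation LQ V := {ffun V -> rat}.

Section Lattice.
Variable V : finType.

Definition Ebase (v : V) : LQ V := [ffun w => (v == w)%:R].

Definition L_pred : {pred LQ V} := fun x => [forall v, x v \is a Num.int].

Fact L_zmod_closed : zmod_closed L_pred.
Proof.
split=> [|x y /forallP hx /forallP hy]; apply/forallP=> v.
  by rewrite ffunE rpred0.
by rewrite !ffunE rpredB.
Qed.
HB.instance Definition _ := GRing.isZmodClosed.Build (LQ V) L_pred L_zmod_closed.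

(* (E_v, E_w), from the edge relation and the decorations b_v = (E_v, E_v). *)
Definition pairing (adj : rel V) (b : V -> int) (v w : V) : int :=
  if v == w then b v else (adj v w)%:R.

Definition form_of (adj : rel V) (b : V -> int) (x y : LQ V) : rat :=
  \sum_(v : V) \sum_(w : V) x v * y w * (pairing adj b v w)%:~R.

End Lattice.

Record plumbing_tree (V : finType) := PlumbingTree {
  adj : rel V;
  decoration : V -> int;
  adj_sym : symmetric adj;
  adj_irr : irreflexive adj;
  tree_nonempty : (0 < #|V|)%N;
  tree_connected : forall v w : V, connect adj v w;
  tree_acyclic : forall s : seq V, (2 < size s)%N -> ~~ ucycleb adj s;
  neg_def : forall x : LQ V, x \in @L_pred V -> x != 0 ->
    form_of adj decoration x x < 0 }.

Section Plumbing.
Variables (V : finType) (T : plumbing_tree V).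

Definition form : LQ V -> LQ V -> rat := form_of (adj T) (decoration T).

Definition valency (v : V) : nat := #|[set w | adj T v w]|.

Definition nodes : {set V} := [set v | 3 <= valency v]%N.

(* A path v = u_0, u_1, ..., u_k = w without repetition; s lists the vertices
   other than the two nodes. *)
Definition orb_adj (v w : V) : bool :=
  [&& v \in nodes, w \in nodes, v != w &
   `[< exists s : seq V, [/\ path (adj T) v (rcons s w),
                             uniq (v :: rcons s w) &
                             all (fun u => valency u == 2)%N s] >] ].

Definition orb_edges : {set {set V}} :=
  [set [set p.1; p.2] | p : V * V & orb_adj p.1 p.2].

Definition L'_pred : {pred LQ V} :=
  fun y => [forall w, form y (Ebase w) \is a Num.int].

Lemma formB x y z : form (x - y) z = form x z - form y z.
Proof.
rewrite /form /form_of -sumrB; apply: eq_bigr => v _; rewrite -sumrB.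
by apply: eq_bigr => w _; rewrite !ffunE !mulrBl.
Qed.

Fact L'_zmod_closed : zmod_closed L'_pred.
Proof.
split=> [|x y /forallP hx /forallP hy]; apply/forallP=> w.
  rewrite /form /form_of big1 ?rpred0 // => v _.
  by rewrite big1 // => u _; rewrite !ffunE !mul0r.
by rewrite formB rpredB.
Qed.
HB.instance Definition _ :=
  GRing.isZmodClosed.Build (LQ V) L'_pred L'_zmod_closed.

Record dual := Dual { dual_val :> LQ V; _ : dual_val \in L'_pred }.
HB.instance Definition _ := [isSub for dual_val].
HB.instance Definition _ := [Choice of dual by <:].
HB.instance Definition _ := [SubChoice_isSubZmodule of dual by <:].

Definition L_in_L' : {pred dual} := fun y => dual_val y \in @L_pred V.

Fact L_in_L'_zmod_closed : zmod_closed L_in_L'.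
Proof.
split=> [|x y hx hy]; rewrite unfold_in /L_in_L'.
  by rewrite -[dual_val 0]/(val (0 : dual)) raddf0 rpred0.
by rewrite -[dual_val _]/(val (x - y)) raddfB rpredB.
Qed.
HB.instance Definition _ :=
  GRing.isZmodClosed.Build dual L_in_L' L_in_L'_zmod_closed.

Definition H := Quotient.quot (L_in_L' : zmodClosed dual).
HB.instance Definition _ := Choice.on H.
HB.instance Definition _ := GRing.Zmodule.on H.
HB.instance Definition _ := EqQuotient.on H.

Definition class (y : dual) : H := (\pi_H y)%qT.

(* The representative of g with all coordinates in [0, 1): see r_P. *)
Definition r_ (g : H) : LQ V :=
  let y : dual := repr g in [ffun v => y v - (Num.floor (y v))%:~R].

Definition int_matrix : 'M[rat]_#|V| :=
  \matrix_(i, j) (pairing (adj T) (decoration T) (enum_val i) (enum_val j))%:~R.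

(* The unique vector with (E_v^*, E_w) = - delta_(v,w): see Estar_valP and
   form_ext. *)
Definition Estar_val (v : V) : LQ V :=
  [ffun w => - invmx int_matrix (enum_rank v) (enum_rank w)].

Lemma form_Ebase (x : LQ V) w :
  form x (Ebase w) = \sum_v x v * (pairing (adj T) (decoration T) v w)%:~R.
Proof.
apply: eq_bigr => v _; rewrite (bigD1 w) //= big1 ?addr0 => [|u uw].
  by rewrite ffunE eqxx mulr1.
by rewrite ffunE eq_sym (negPf uw) mulr0 mul0r.
Qed.

Lemma int_matrix_unit : int_matrix \in unitmx.
Proof.
rewrite -row_free_unit -kermx_eq0; apply/rowV0P=> u /sub_kermxP uB0.
apply/eqP; apply: contraT => u0.
pose d : int := \prod_j denq (u 0 j).
have d0 : d != 0 by apply/prodf_neq0=> j _; exact: denq_neq0.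
pose x : LQ V := [ffun v => d%:~R * u 0 (enum_rank v)].
have xL : x \in @L_pred V.
  apply/forallP=> v; rewrite ffunE /d (bigD1 (enum_rank v)) //= intrM mulrAC.
  by rewrite [X in X * _]mulrC -numqE -intrM intr_int.
have x0 : x != 0.
  apply: contra u0 => /eqP x0; apply/eqP/rowP=> j; rewrite mxE.
  have /eqP := congr1 (fun f : LQ V => f (enum_val j)) x0.
  by rewrite !ffunE enum_valK mulf_eq0 intr_eq0 (negPf d0) => /eqP.
have := neg_def T xL x0; suff -> : form_of (adj T) (decoration T) x x = 0.
  by rewrite ltxx.
rewrite /form_of exchange_big /= big1 // => w _.
have := congr1 (fun M : 'rV[rat]_#|V| => M 0 (enum_rank w)) uB0.
rewrite !mxE (reindex (@enum_rank V)) /=; last first.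
  by apply: onW_bij; exact: enum_rank_bij.
move=> e; transitivity (d%:~R * x w * 0); last by rewrite mulr0.
rewrite -[X in _ = _ * X]e mulr_sumr; apply: eq_bigr => v _.
by rewrite mxE !enum_rankK [x v]ffunE mulrACA -!mulrA; congr (_ * _); rewrite mulrCA.
Qed.

Lemma Estar_valP v w : form (Estar_val v) (Ebase w) = - (v == w)%:R.
Proof.
rewrite form_Ebase; have := mulVmx int_matrix_unit.
move/(congr1 (fun M : 'M[rat]_#|V| => - M (enum_rank v) (enum_rank w))).
rewrite !mxE (inj_eq enum_rank_inj) => <-.
rewrite (reindex (@enum_rank V)) /=; last by apply: onW_bij; exact: enum_rank_bij.
by rewrite -sumrN; apply: eq_bigr => u _; rewrite mxE !enum_rankK ffunE mulNr.
Qed.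

Fact Estar_subproof v : Estar_val v \in L'_pred.
Proof. by apply/forallP=> w; rewrite Estar_valP rpredN rpred_nat. Qed.

Definition Estar (v : V) : dual := Dual (Estar_subproof v).

Definition int_S' (s : dual) : Prop :=
  exists2 n : V -> nat, (forall v, 0 < n v)%N & s = \sum_v Estar v *+ n v.

Lemma form_ext (x y : LQ V) :
  (forall w, form x (Ebase w) = form y (Ebase w)) -> x = y.
Proof.
move=> exy; apply/eqP; rewrite -subr_eq0; apply/eqP.
pose u : 'rV[rat]_#|V| := \row_j (x - y) (enum_val j).
have uB : u *m int_matrix = 0.
  apply/rowP=> j; rewrite !mxE.
  have := form_Ebase (x - y) (enum_val j); rewrite formB exy subrr => e.
  rewrite [RHS]e [RHS](reindex (@enum_val V predT)) /=; last first.
    by apply: onW_bij; exact: enum_val_bij.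
  by apply: eq_bigr => i _; rewrite !mxE.
have u0 : u = 0 by rewrite -[u](mulmxK int_matrix_unit) uB mul0mx.
apply/ffunP=> v; have := congr1 (fun M : 'rV[rat]_#|V| => M 0 (enum_rank v)) u0.
by rewrite !mxE enum_rankK => ->; rewrite ffunE.
Qed.

Lemma r_P (g : H) : exists l : dual,
  [/\ dual_val l = r_ g, class l = g & forall v, 0 <= l v < 1].
Proof.
pose y : dual := repr g.
have rE v : r_ g v = y v - (Num.floor (y v))%:~R by rewrite ffunE.
pose z : LQ V := [ffun v => (Num.floor (y v))%:~R].
have zL' : z \in L'_pred.
  apply/forallP=> w; rewrite form_Ebase rpred_sum // => v _.
  by rewrite ffunE rpredM // intr_int.
exists (y - Dual zL'); split.
- by apply/ffunP=> v; rewrite rE !ffunE.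
- rewrite -[RHS]reprK; apply/eqP; rewrite /class -Quotient.idealrBE.
  rewrite addrAC subrr add0r rpredN; apply/forallP=> v.
  by rewrite /= ffunE intr_int.
move=> v; have -> : (y - Dual zL') v = y v - (Num.floor (y v))%:~R.
  by rewrite /= !ffunE.
by rewrite subr_ge0 ltrBlDr addrC -[1]/(1%:~R) -intrD; exact: floor_itv.
Qed.

End Plumbing.

(** Formal series with integer coefficients and exponents in an abelian group G.
    With G = L (x) Q these are series in t^y; with G = H * (L (x) Q) they are
    series in t^y with coefficients in Z[H], the value at (h, y) being the
    coefficient of h t^y. *)
Section Series.
Variable G : zmodType.
Local Open Scope classical_set_scope.

Definition series := G -> int.

Definition mono (g : G) : series := fun x => (x == g)%:R.

(* For the series at hand all these sums have finitely many nonzero terms. *)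
Definition smul (A B : series) : series :=
  fun x => \sum_(y \in [set: G]) A y * B (x - y).

Definition sprod (I : finType) (P : {pred I}) (F : I -> series) : series :=
  \big[smul/mono 0]_(i in P) F i.

(* The coefficient of z^n in the Taylor expansion of (1 - z)^k; Negz m stands
   for - (m + 1). *)
Definition binom_coef (k : int) (n : nat) : int :=
  match k with
  | Posz m => (-1) ^+ n * 'C(m, n)%:R
  | Negz m => 'C(m + n, n)%:R
  end.

(* T[(1 - z)^k] at the monomial z of exponent g, which is of infinite order. *)
Definition binom_series (g : G) (k : int) : series :=
  fun x => \sum_(n \in [set n : nat | g *+ n = x]) binom_coef k n.

End Series.

Section Counting.
Variables (V : finType) (T : plumbing_tree V).
Local Open Scope classical_set_scope.

(* The exponent of t_I^y. *)
Definition restr (I : {set V}) (y : LQ V) : LQ V :=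
  [ffun v => if v \in I then y v else 0].

Definition Coeff (S : series (LQ V)) (I : {set V}) (x : LQ V) : int :=
  S (restr I x).

Definition pser : series (LQ V) :=
  sprod predT (fun v =>
    binom_series (Estar T v : LQ V) ((valency T v)%:Z - 2)).

(* T[prod_v (1 - [e_v] t^e_v)^(delta_v - 2)] with e_v = Estar v. *)
Definition equivariant_ser : series (H T * LQ V)%type :=
  sprod predT (fun v =>
    binom_series (class (Estar T v), Estar T v : LQ V)
      ((valency T v)%:Z - 2)).

Definition f_ (h : H T) : series (LQ V) := fun y => equivariant_ser (h, y).

(* T[f_h(t_I)]: setting t_v = 1 for v outside I projects the exponents to I. *)
Definition f_at (h : H T) (I : {set V}) : series (LQ V) :=
  fun y => \sum_(l \in [set l : LQ V | restr I l = y]) f_ h l.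

(* T[t_I^(- r_(h - [x])) f_h(t_I) prod_(i in I) t_I^(E_i) / (1 - t_I^(E_i))] *)
Definition modified_ser (h : H T) (x : dual T) (I : {set V}) : series (LQ V) :=
  smul (smul (mono (restr I (- r_ (h - class x)))) (f_at h I))
    (sprod (mem I) (fun i =>
       smul (mono (restr I (Ebase i))) (binom_series (restr I (Ebase i)) (-1)))).

Definition Qred (h : H T) (x : dual T) : int :=
  \sum_(l \in [set l : dual T |
                 class l = h /\ exists2 v, v \in nodes T & l v < x v])
    pser l.

End Counting.

(* Main.v *)
Require Import Defs.
From mathcomp Require Import all_boot all_order all_algebra.
From mathcomp Require Import boolp classical_sets fsbigop.
From mathcomp Require Import zify ring lra.

Set Implicit Arguments.
Unset Strict Implicit.
Unset Printing Implicit Defensive.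

Import Order.TTheory GRing.Theory Num.Theory.
Local Open Scope ring_scope.

(** Fix a class h. The exponents l of class h that can occur in the series are
the points lh + i, where lh is the representative of h with coordinates in [0,
1) and i runs over vectors of natural numbers. The coefficient of l is the
product over the vertices v of the coefficients of (1 - z)^(delta_v - 2) at the
dual coordinates n_v(l) = - (l, E_v), by [f_point] and [pser_point]. Write S(l)
for the set of nodes v with l_v < x_v. The counting function sums the
coefficients of the l with S(l) nonempty, and the modified series attached to I
contributes the sum over the l with I contained in S(l) ([Qred_box] and
[Coeff_box]; the sums are finite because the entries of Estar are positive).

Root the tree at a node r; the edges of the orbifold graph are then the pairs
{v, next v}, where next v is the first node strictly above v ([orb_edgesE]).
Order the nodes so that a node comes after the nodes nearer to the root.
Counting the first element of S(l) in two ways gives ([component_count])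

  [S nonempty] = sum_v [v in S] - sum_(v <> r) [v in S and next v in S]
                 - sum_(v <> r) sum_j [v in S, next v not in S,
                                       j is the first node of S, j before v].

The first two sums are the right-hand side of the theorem, so it remains to see
that for fixed v and j the weighted sum of the last indicator over l vanishes.
In its conditions u = next v lies outside S, while v and j are in S and lie on
different sides of the edge from u to the vertex below it on the way to v.

This vanishing is [weighted_sum_eq0], which treats any conditions phi_w(l_w)
that depend on one coordinate each and are constant, equal to eps_w, when l_w
>= x_w; it asks that phi_u be 0 when l_u < x_u, and that eps vanish at some
vertex on each side of the edge. The leaves of the tree are summed out one
after the other, the ones furthest from u first, until only the edge from u to
c is left. When some of the branches at w have been summed out, the factor at w
is a finite difference (of order one less than the remaining valency of w) of a
sequence E_w(l, m) which, for each l >= x_w, takes a constant value as soon as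
m passes a bound that is affine in l: merging a leaf v into its parent p
replaces E_p by the convolution of the difference of E_p with the sequence of
values of E_v, which adds the bounds and multiplies the limits
([conv_diff_eventually]). The hypothesis on x gives n_v(x) >= delta_v - 1, and
this is what makes the bounds propagate along the tree ([leaf_bound]); the
slopes are ratios of coordinates of Estar u. For the last edge, E_u has limit 0
because of j and E_c has limit 0 because of v, and for each pair of values of
l_u and l_c with l_u >= x_u at least one of the two has reached its limit
([term_edge_eq0]). *)

(** * Differences and convolutions of integer sequences *)

(** Multiplication by 1 - z of the Laurent series with coefficients f. *)
Definition diff (f : int -> int) : int -> int := fun m => f m - f (m - 1).

(** The sequences that correspond to power series. *)
Definition causal (f : int -> int) := forall m, m < 0 -> f m = 0.

(** The Cauchy product.  For causal f the terms with j > m vanish, so that the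
cut at `|m| is harmless, see [convE]; it also makes [conv f g] defined, and 0,
for negative m. *)
Definition conv (f : int -> int) (g : nat -> int) : int -> int :=
  fun m => \sum_(j < `|m|.+1) f (m - j%:Z) * g j.

Lemma causal_diff f : causal f -> causal (diff f).
Proof. by move=> cf m m0; rewrite /diff !cf ?subrr //; lia. Qed.

Lemma convE f g m n : causal f -> m < n%:Z ->
  conv f g m = \sum_(j < n) f (m - j%:Z) * g j.
Proof.
move=> cf mn.
have tail k : m < k%:Z -> forall d,
    \sum_(j < k) f (m - j%:Z) * g j = \sum_(j < k + d) f (m - j%:Z) * g j.
  move=> mk; elim=> [|d IHd]; first by rewrite addn0.
  by rewrite addnS big_ord_recr /= -IHd cf ?mul0r ?addr0 //; lia.
rewrite /conv (tail _ _ n) 1?(tail n mn `|m|.+1); last by lia.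
by rewrite addnC.
Qed.

Lemma causal_conv f g : causal f -> causal (conv f g).
Proof. by move=> cf m m0; rewrite (@convE _ _ _ 0) ?big_ord0. Qed.

Lemma diff_conv f g : causal f -> diff (conv f g) = conv (diff f) g.
Proof.
move=> cf; apply/funext=> m.
rewrite /diff !(@convE _ _ _ `|m|.+1) //; try lia; last exact: causal_diff.
rewrite -sumrB; apply: eq_bigr => j _.
by rewrite /diff -mulrBl; congr ((_ - f _) * _); lia.
Qed.

Lemma causal_iter_diff k f : causal f -> causal (iter k diff f).
Proof. by move=> cf; elim: k => //= k IHk; exact: causal_diff. Qed.

Lemma iter_diff_conv k f g : causal f ->
  iter k diff (conv f g) = conv (iter k diff f) g.
Proof.
move=> cf; elim: k => //= k ->; rewrite diff_conv //; exact: causal_iter_diff.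
Qed.

(** If f is eventually a, with threshold b, and g is eventually e, with threshold
s, then the product of the two series by 1 - z is eventually a * e: the
differences of f vanish beyond b + 1, and they sum to a.  The thresholds are
rational because they come from coordinates in the dual lattice. *)
Lemma conv_diff_eventually f g (b s : rat) a e m : causal f ->
  (forall k : int, b <= k%:~R -> f k = a) ->
  (forall j : nat, s < j%:R -> g j = e) ->
  0 <= b -> 0 <= s + 1 -> b + (s + 1) <= m%:~R ->
  conv (diff f) g m = a * e.
Proof.
move=> cf fa ge b0 s0 bsm.
have m0 : 0 <= m by rewrite -(ler0z rat); lra.
have fm : f m = a by apply: fa; lra.
case: m m0 bsm fm => // M _ bsm fm.
(* a nonzero difference at M - j forces M - j < b + 1, hence s < j *)
rewrite (@convE _ _ _ M.+1); [|exact: causal_diff|by lia].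
have -> : \sum_(j < M.+1) diff f (M%:Z - j%:Z) * g j =
          \sum_(j < M.+1) diff f (M%:Z - j%:Z) * e.
  apply: eq_bigr => j _; have [/ge->//|js] := ltP s j%:R.
  have jE : (Posz j)%:~R = j%:R :> rat by [].
  by rewrite /diff !fa ?subrr ?mul0r // !intrB ?jE; lra.
rewrite -mulr_suml; congr (_ * _); rewrite -fm.
have tele k : \sum_(j < k) diff f (M%:Z - j%:Z) = f M%:Z - f (M%:Z - k%:Z).
  elim: k => [|k IHk]; first by rewrite big_ord0 subr0 subrr.
  rewrite big_ord_recr /= IHk /diff addrA subrK; congr (_ - f _); lia.
by rewrite tele [X in _ - X]cf ?subr0 //; lia.
Qed.

(** The coefficient of z^m in (1 - z)^k, extended by 0 to negative m. *)
Definition binom_coefz (k m : int) : int :=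
  if m is Posz n then binom_coef k n else 0.

Lemma diff_binom k : diff (binom_coefz (k%:Z - 1)) = binom_coefz k%:Z.
Proof.
apply/funext=> -[n|n]; last first.
  by rewrite /diff (_ : Negz n - 1 = Negz n.+1) ?subrr //; lia.
case: k => [|k]; last have -> : k.+1%:Z - 1 = k%:Z by lia.
  case: n => [|n]; first by rewrite /diff /= subr0.
  rewrite /diff (_ : n.+1%:Z - 1 = n%:Z); last by lia.
  by rewrite /= ?add0n !binn subrr mulr0.
case: n => [|n]; first by rewrite /diff /= !bin0 subr0.
rewrite /diff (_ : n.+1%:Z - 1 = n%:Z); last by lia.
by rewrite /= binS natrD exprS; ring.
Qed.

(** The powers of 1 - z with exponent at least - 1, as iterated differences of the
unit step, which is the series of 1 / (1 - z). *)
Lemma iter_diff_step k (a m : int) :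
  iter k diff (fun m : int => a * (0 <= m)%R%:R)%R m = a * binom_coefz (k.+1%:Z - 2) m.
Proof.
have -> : k.+1%:Z - 2 = k%:Z - 1 by lia.
elim: k m => [|k IHk] m.
  by case: m => n //=; rewrite ?add0n ?binn.
rewrite iterS /diff !IHk -mulrBr; congr (_ * _).
have -> : k.+1%:Z - 1 = k%:Z by lia.
by rewrite -diff_binom.
Qed.

Lemma ltz_maxn_abs (m : int) n : m < (maxn `|m|.+1 n)%:Z.
Proof. lia. Qed.

(** * Pruning the tree down to an edge *)

(** A tree with adjacency relation adj is rooted at u, with parent function par,
and c is a neighbour of u; side tells the two sides of the edge from u to c
apart.  The integers e v are the opposites of the self-intersections.  The
vectors x, rh and y are rational: rh + i, for i : V -> nat, runs over the points
of interest, x is the vector they are compared with, and y is positive with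
vanishing dual coordinates away from u; in the application it is Estar u. *)
Section Peel.
Variables (V : finType) (adj : rel V) (u c : V) (par : V -> V) (d : V -> nat).
Variables (side : V -> bool) (e cst : V -> int) (x rh y : V -> rat) (B : nat).
Hypothesis adj_sym : symmetric adj.
Hypothesis adj_irr : irreflexive adj.
Hypothesis c_neq_u : c != u.
Hypothesis par_c : par c = u.
Hypothesis adj_par : forall v, v != u -> adj v (par v).
Hypothesis d_par : forall v, v != u -> (d (par v) < d v)%N.
Hypothesis adjE : forall v w, adj v w ->
  (v != u /\ par v = w) \/ (w != u /\ par w = v).
Hypothesis side_c : side c.
Hypothesis side_u : ~~ side u.
Hypothesis side_par : forall v, v != u -> v != c -> side (par v) = side v.
Hypothesis y_gt0 : forall v, 0 < y v.
Hypothesis yE : forall v, v != u -> (e v)%:~R * y v = \sum_(w | adj v w) y w.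
Hypothesis y_root : \sum_(w | adj u w) y w <= (e u)%:~R * y u.
Hypothesis x_large : forall v,
  \sum_(w | adj v w) (x w + 1) - 1 <= (e v)%:~R * x v.
Hypothesis x_rh : forall v, 0 <= x v - rh v + 1.
Hypothesis cstE : forall v,
  (cst v)%:~R = (e v)%:~R * rh v - \sum_(w | adj v w) rh w.

(** The dual coordinate of rh + i at v; [cst v] is the dual coordinate of rh. *)
Definition dualc (i : V -> nat) (v : V) : int :=
  cst v + e v * (i v)%:Z - \sum_(w | adj v w) (i w)%:Z.

(** The coordinate rh v + l at v is at least x v. *)
Definition good (v : V) (l : nat) : bool := x v <= rh v + l%:R.

(** The valency of v in the subtree spanned by R. *)
Definition degin (R : {set V}) (v : V) : nat := #|[set w in R | adj v w]|.

(** The contribution of i to the sum that remains when the vertices outside R have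
been summed out.  The valency in R is positive when R spans a subtree containing
u and c. *)
Definition term (R : {set V}) (E : V -> nat -> int -> int) (i : V -> nat) :=
  \prod_(v in R) iter (degin R v).-1 diff (E v (i v)) (dualc i v).

(** If the coordinate at v is rh v + l, a value j at the branch of v through w is
beyond the threshold when [slope v w l < j], that is, when rh w + j - x w is
greater than (y w / y v) * (rh v + l - x v). *)
Definition slope (v w : V) (l : nat) : rat :=
  x w - rh w + y w / y v * (rh v + l%:R - x v).

(** At a good l, the sequence E v l has reached its limit eps v beyond the sum of
the thresholds of the branches at v that have been summed out. *)
Definition stable (R : {set V}) (E : V -> nat -> int -> int) (eps : V -> int) :=
  forall v l (m : int), v \in R -> good v l ->
    \sum_(w | adj v w && (w \notin R)) (slope v w l + 1) <= m%:~R ->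
    0 <= m -> E v l m = eps v.

Definition upd (i : V -> nat) v j := fun w => if w == v then j else i w.

Lemma sum_split v (R : {set V}) (F : V -> rat) p : adj v p -> p \in R ->
  (forall w, adj v w -> w \in R -> w = p) ->
  \sum_(w | adj v w) F w = F p + \sum_(w | adj v w && (w \notin R)) F w.
Proof.
move=> vp pR only; rewrite (bigD1 p) //=; congr (_ + _); apply: eq_bigl => w.
case vw: (adj v w) => //=; case: (boolP (w \in R)) => wR.
  by rewrite (only w) // eqxx.
by apply/eqP=> wp; rewrite wp pR in wR.
Qed.

(** A value at the leaf v of R beyond the threshold set by its parent p is good,
and the corresponding dual coordinate at v lies beyond the thresholds of the
branches of v that do not contain p.  This is where [x_large] and [yE] enter. *)
Lemma leaf_bound v p (R : {set V}) l j : v != u -> par v = p -> p \in R ->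
  (forall w, adj v w -> w \in R -> w = p) ->
  good p l -> slope p v l < j%:R ->
  good v j /\
  \sum_(w | adj v w && (w \notin R)) (slope v w j + 1) <=
    (cst v + e v * j%:Z - l%:Z)%:~R.
Proof.
move=> vu vp pR only gl jl.
have avp : adj v p by rewrite -vp adj_par.
have py := y_gt0 p; have vy := y_gt0 v.
have jd : y v / y p * (rh p + l%:R - x p) < rh v + j%:R - x v.
  by move: jl; rewrite /slope; lra.
have d0 : 0 <= rh p + l%:R - x p by rewrite subr_ge0.
have j0 : 0 <= rh v + j%:R - x v.
  apply: le_trans (ltW jd); apply: mulr_ge0 => //.
  by rewrite divr_ge0 // ltW.
split; first by rewrite /good -subr_ge0.
have jd' : rh p + l%:R - x p <= y p / y v * (rh v + j%:R - x v).
  rewrite mulrAC ler_pdivlMr // [_ * y v]mulrC.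
  by move: jd; rewrite mulrAC ltr_pdivrMr // mulrC => /ltW; rewrite [_ * y p]mulrC.
rewrite intrB intrD intrM cstE.
have := x_large v; have := yE vu.
rewrite !(sum_split _ avp pR only).
have -> : \sum_(w | adj v w && (w \notin R)) (slope v w j + 1) =
    \sum_(w | adj v w && (w \notin R)) (x w + 1)
    - \sum_(w | adj v w && (w \notin R)) rh w
    + (\sum_(w | adj v w && (w \notin R)) y w) *
      ((rh v + j%:R - x v) / y v).
  rewrite mulr_suml -sumrB -big_split /=; apply: eq_bigr => w _.
  by rewrite /slope; field; rewrite gt_eqF.
set Y := \sum_(w | _) y w; set X := \sum_(w | _) (x w + 1).
set H := \sum_(w | _) rh w => yv xv.
have -> : Y = (e v)%:~R * y v - y p by rewrite yv; lra.
have -> : ((e v)%:~R * y v - y p) * ((rh v + j%:R - x v) / y v) =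
  (e v)%:~R * (rh v + j%:R - x v) - y p / y v * (rh v + j%:R - x v).
  by field; rewrite gt_eqF.
rewrite !pmulrn; move: jd'; rewrite !pmulrn.
move: (y p / y v * _) => Z; move: xv.
rewrite !mulrBr !mulrDr. lra.
Qed.

Lemma sum_upd v w i j : i v = 0%N ->
  \sum_(w' | adj w w') ((upd i v j w')%:Z) =
  \sum_(w' | adj w w') (i w')%:Z + (if adj w v then j%:Z else 0).
Proof.
move=> iv; case: ifPn => wv; last first.
  rewrite addr0; apply: eq_bigr => w' ww'; rewrite /upd.
  by case: eqP wv ww' => // -> /negPf->.
rewrite (bigD1 v) //= [in RHS](bigD1 v) //= iv /upd eqxx add0r addrC.
by congr (_ + _); apply: eq_bigr => w' /andP[_ /negPf->].
Qed.

Lemma dualc_upd v w i j : i v = 0%N -> w != v ->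
  dualc (upd i v j) w = dualc i w - (if adj w v then j%:Z else 0).
Proof.
by move=> iv wv; rewrite /dualc sum_upd // {1}/upd (negPf wv) opprD addrA.
Qed.

(** Summing out a leaf v of the subtree spanned by R. *)
Section Step.
Variables (R : {set V}) (E : V -> nat -> int -> int) (v : V).
Hypothesis cR : c \in R.
Hypothesis parR : forall w, w \in R -> w != u -> par w \in R.
Hypothesis vR : v \in R.
Hypothesis vu : v != u.
Hypothesis vc : v != c.
Hypothesis only : forall w, adj v w -> w \in R -> w = par v.
Hypothesis causalE : forall w l, w \in R -> causal (E w l).

Let p := par v.
Let R' := R :\ v.

(** The new factors: at the parent p of v, the sum over the values j at v is a
convolution, and one of the differences at p is absorbed into it, since the
valency of p drops by one. *)
Definition merge (w : V) (l : nat) : int -> int :=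
  if w == p then
    conv (diff (E p l)) (fun j => E v j (cst v + e v * j%:Z - l%:Z))
  else E w l.

Let avp : adj v p. Proof. exact: adj_par. Qed.
Let pR : p \in R. Proof. exact: parR. Qed.
Let pv : p != v. Proof. by apply/eqP=> h; move: avp; rewrite h adj_irr. Qed.

Lemma degin_leaf : degin R v = 1%N.
Proof.
rewrite /degin (_ : [set _ in _ | _] = [set p]) ?cards1 //.
apply/setP=> w; rewrite !inE; apply/andP/eqP=> [[wR vw]|->]; first exact: only.
by rewrite pR avp.
Qed.

Lemma degin_par : degin R p = (degin R' p).+1.
Proof.
rewrite /degin (cardsD1 v) !inE vR adj_sym avp /= add1n; congr _.+1.
by apply: eq_card => w; rewrite !inE andbA.
Qed.

Lemma degin_par_gt0 : (0 < degin R' p)%N.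
Proof.
rewrite /degin; apply/card_gt0P; case: (eqVneq p u) => [->|pu].
  by exists c; rewrite !inE eq_sym vc cR -par_c adj_sym adj_par.
exists (par p); rewrite !inE adj_par // parR // !andbT.
apply/eqP=> h; have := d_par pu; rewrite h => /(ltn_trans (d_par vu)).
by rewrite ltnn.
Qed.

Lemma degin_other w : w \in R -> w != p -> degin R' w = degin R w.
Proof.
move=> wR wp; apply: eq_card => w'; rewrite !inE.
case: eqP => //= ->; case wv: (adj w v); rewrite ?andbF //.
by rewrite (only (w := w)) ?eqxx // adj_sym in wp.
Qed.

Lemma dualc_leaf i j : (forall w, w \notin R' -> i w = 0%N) ->
  dualc (upd i v j) v = cst v + e v * j%:Z - (i p)%:Z.
Proof.
move=> supp; rewrite /dualc /upd eqxx; congr (_ - _).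
rewrite (bigD1 p) //= (negPf pv) big1 ?addr0 // => w /andP[vw wp].
case: (eqVneq w v) => [wv|wv]; first by rewrite wv adj_irr in vw.
rewrite supp // !inE wv /=; apply: contra wp => wR; apply/eqP; exact: only.
Qed.

Let rest (i : V -> nat) :=
  \prod_(w in R' | w != p) iter (degin R w).-1 diff (E w (i w)) (dualc i w).

Lemma term_upd i j : (forall w, w \notin R' -> i w = 0%N) ->
  term R E (upd i v j) =
  rest i * (iter (degin R' p) diff (E p (i p)) (dualc i p - j%:Z) *
            E v j (cst v + e v * j%:Z - (i p)%:Z)).
Proof.
move=> supp; have iv : i v = 0%N by rewrite supp // !inE eqxx.
rewrite /term (bigD1 v) //= degin_leaf /= dualc_leaf //.
rewrite {1}/upd eqxx (bigD1 p) /=; last by rewrite pR pv.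
rewrite degin_par /= {1}/upd (negPf pv) dualc_upd // adj_sym avp.
rewrite mulrC [RHS]mulrA [rest i * _]mulrC; congr (_ * _ * _).
apply: eq_big => [w|w /andP[/andP[wR wv] wp]].
  by rewrite !inE [_ && (w \in R)]andbC.
rewrite dualc_upd // {1}/upd (negPf wv).
case: ifP => [wv'|]; last by rewrite subr0.
by rewrite (only (w := w)) ?eqxx // adj_sym in wp.
Qed.

Lemma term_merge i : (forall w, w \notin R' -> i w = 0%N) ->
  term R' merge i =
  rest i * conv (iter (degin R' p) diff (E p (i p)))
     (fun j => E v j (cst v + e v * j%:Z - (i p)%:Z)) (dualc i p).
Proof.
move=> supp; rewrite /term (bigD1 p) /=; last by rewrite !inE pv pR.
rewrite mulrC; congr (_ * _).
  apply: eq_bigr => w; rewrite !inE => /andP[/andP[wv wR] wp].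
  by rewrite /merge (negPf wp) degin_other.
rewrite /merge eqxx iter_diff_conv; last by apply: causal_diff; exact: causalE.
by rewrite -iterSr prednK // degin_par_gt0.
Qed.

Hypothesis bounded : forall i, (forall w, w \notin R -> i w = 0%N) ->
  term R E i != 0 -> forall w, (i w <= B)%N.

Let supp_upd i j : (forall w, w \notin R' -> i w = 0%N) ->
  forall w, w \notin R -> upd i v j w = 0%N.
Proof.
move=> supp w wR; rewrite /upd; case: eqP => [wv|_]; first by rewrite wv vR in wR.
by rewrite supp // !inE (negPf wR) andbF.
Qed.

(** Only the values j up to B contribute by boundedness, and only those up to the
dual coordinate at p contribute by causality; the two ranges are compared inside
a common one. *)
Lemma term_merge_sum i : (forall w, w \notin R' -> i w = 0%N) ->
  term R' merge i = \sum_(j < B.+1) term R E (upd i v j).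
Proof.
move=> supp; rewrite term_merge //.
pose n := maxn `|dualc i p|.+1 B.+1.
have mn : dualc i p < n%:Z.
  exact: ltz_maxn_abs.
rewrite (convE _ _ mn); last exact/causal_iter_diff/causalE.
rewrite mulr_sumr (big_ord_widen n (fun j => term R E (upd i v j))); last first.
  by rewrite leq_maxr.
rewrite [RHS]big_mkcond /=; apply: eq_bigr => j _.
rewrite -term_upd //; case: ifPn => // jB.
apply/eqP; apply: contraNT jB => /(bounded (supp_upd j supp))/(_ v).
by rewrite /upd eqxx.
Qed.

Lemma bounded_merge i : (forall w, w \notin R' -> i w = 0%N) ->
  term R' merge i != 0 -> forall w, (i w <= B)%N.
Proof.
move=> supp; rewrite term_merge_sum // => nz w.
have [j nzj] : exists j : 'I_B.+1, term R E (upd i v j) != 0.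
  apply/existsP; apply: contraNT nz => /existsPn z.
  by rewrite big1 // => j _; apply/eqP; rewrite -[_ == _]negbK z.
have /(_ w) := bounded (supp_upd j supp) nzj; rewrite /upd.
by case: eqP => // ->; rewrite supp // !inE eqxx.
Qed.

Lemma causal_merge w l : w \in R' -> causal (merge w l).
Proof.
rewrite !inE /merge => /andP[_ wR]; case: eqP => _; last exact: causalE.
exact/causal_conv/causal_diff/causalE.
Qed.

Lemma slope_ge0 w w' l : good w l -> 0 <= slope w w' l + 1.
Proof.
move=> gl; rewrite /slope addrAC addr_ge0 //.
by apply: mulr_ge0; rewrite ?subr_ge0 // divr_ge0 // ltW.
Qed.

Lemma stable_merge eps : stable R E eps ->
  stable R' merge (fun w => if w == p then eps p * eps v else eps w).
Proof.
move=> st w l m wR' gl; have [wv wR] := setD1P wR'.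
rewrite /merge; case: (eqVneq w p) => [wp|wp].
  rewrite wp in wR gl * => lem m0.
  have vR' : v \notin R' by rewrite !inE eqxx.
  move: lem; rewrite (bigD1 v) /=; last by rewrite vR' adj_sym avp.
  under eq_bigl => w'.
    rewrite !inE -andbA [(~~ (_ && _)) && _](_ : _ = (w' \notin R)); last first.
      by case: (eqVneq w' v) => //= [->|_]; rewrite ?vR ?andbT.
    over.
  set b := (X in _ + X) => lem.
  apply: (conv_diff_eventually (b := b) (s := slope p v l)).
  - exact: causalE.
  - move=> k bk; apply: st => //.
    rewrite -(ler0z rat); apply: le_trans bk.
    by apply: sumr_ge0 => w' _; exact: slope_ge0.
  - move=> j /(leaf_bound vu (erefl _) pR only gl)[gj lej].
    apply: st => //; rewrite -(ler0z rat); apply: le_trans lej.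
    by apply: sumr_ge0 => w' _; exact: slope_ge0.
  - by apply: sumr_ge0 => w' _; exact: slope_ge0.
  - exact: slope_ge0.
  - by rewrite addrC.
move=> lem m0; apply: st => //; apply: le_trans lem.
rewrite le_eqVlt; apply/orP; left; apply/eqP; apply: eq_bigl => w'.
rewrite !inE; case: (eqVneq w' v) => //= ->; rewrite vR /=.
case wv': (adj w v) => //.
by rewrite (only (w := w)) ?eqxx // adj_sym in wp.
Qed.

End Step.

(** The box of vectors with entries at most B that vanish outside R. *)
Definition supported (R : {set V}) (i : {ffun V -> 'I_B.+1}) :=
  [forall w, (w \in R) || (i w == 0%N :> nat)].

Lemma supportedP (R : {set V}) (i : {ffun V -> 'I_B.+1}) :
  reflect (forall w, w \notin R -> i w = 0%N :> nat) (supported R i).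
Proof.
apply: (iffP forallP) => [h w wR|h w]; first by have := h w; rewrite (negPf wR) => /eqP.
by case: (boolP (w \in R)) => //= wR; rewrite h.
Qed.

Lemma sum_supported (R : {set V}) v (F : (V -> nat) -> int) : v \in R ->
  \sum_(i : {ffun V -> 'I_B.+1} | supported R i) F (fun w => i w) =
  \sum_(i : {ffun V -> 'I_B.+1} | supported (R :\ v) i)
     \sum_(j < B.+1) F (upd (fun w => i w) v j).
Proof.
move=> vR.
pose erase (i : {ffun V -> 'I_B.+1}) : {ffun V -> 'I_B.+1} :=
  [ffun w => if w == v then ord0 else i w].
pose put (i : {ffun V -> 'I_B.+1}) (j : 'I_B.+1) : {ffun V -> 'I_B.+1} :=
  [ffun w => if w == v then j else i w].
rewrite (partition_big erase (supported (R :\ v))) /=; last first.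
  move=> i /supportedP si; apply/supportedP=> w; rewrite !inE ffunE.
  by case: eqP => //= _ /si.
apply: eq_bigr => i /supportedP si.
have iv : i v = ord0 by apply: val_inj => /=; rewrite si // !inE eqxx.
rewrite (reindex_onto (put i) (fun i' => i' v)) /=; last first.
  move=> i' /andP[_ /eqP <-]; apply/ffunP=> w; rewrite !ffunE.
  by case: eqP => // ->.
apply: eq_big => [j|j _]; last first.
  by congr F; apply/funext=> w; rewrite /upd ffunE; case: eqP.
rewrite ffunE !eqxx andbT; apply/andP; split.
  apply/supportedP=> w wR; rewrite ffunE; case: eqP => [wv|_].
    by rewrite wv vR in wR.
  by rewrite si // !inE (negPf wR) andbF.
by apply/eqP/ffunP=> w; rewrite !ffunE; case: eqP => // ->.
Qed.

(** When only the edge from u to c is left, every term vanishes.  If the value at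
c is beyond the threshold set by the value at u, then the factor at c equals
[eps c]; otherwise the dual coordinate at u is so large that the factor at u
equals [eps u]. *)
Lemma term_edge_eq0 (R : {set V}) E eps (i : V -> nat) :
  u \in R -> c \in R -> (forall w, w \in R -> w = u \/ w = c) ->
  stable R E eps -> (forall l m, ~~ good u l -> E u l m = 0) ->
  eps u = 0 -> eps c = 0 ->
  (forall w, w \notin R -> i w = 0%N) -> term R E i = 0.
Proof.
move=> uR cR Ruc st Ebad epsu epsc si.
have auc : adj u c by rewrite adj_sym -par_c adj_par.
have onlyu w : adj u w -> w \in R -> w = c.
  by move=> uw /Ruc[wu|//]; rewrite wu adj_irr in uw.
have onlyc w : adj c w -> w \in R -> w = u.
  by move=> uw /Ruc[//|wu]; rewrite wu adj_irr in uw.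
have deg0 a b : a \in R -> b \in R -> (forall w, adj a w -> w \in R -> w = b) ->
    (degin R a).-1 = 0%N.
  move=> aR bR ab; suff : (degin R a <= 1)%N by case: (degin R a) => [|[]].
  rewrite /degin -(cards1 b); apply: subset_leq_card; apply/fintype.subsetP=> w.
  by rewrite !inE => /andP[wR aw]; rewrite (ab w).
have dualcE a b : adj a b -> b \in R -> (forall w, adj a w -> w \in R -> w = b) ->
    dualc i a = cst a + e a * (i a)%:Z - (i b)%:Z.
  move=> ab bR only; rewrite /dualc (bigD1 b) //= big1 ?addr0 // => w /andP[aw wb].
  rewrite si //; apply: contra wb => wR; apply/eqP; exact: only.
rewrite /term (bigD1 u) //= (bigD1 c) /=; last by rewrite cR c_neq_u.
rewrite (deg0 u c) // (deg0 c u) //= (dualcE u c) // (dualcE c u) ?[adj c u]adj_sym //.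
have [gu|/Ebad ->] := boolP (good u (i u)); last by rewrite mul0r.
have nonneg a (l : nat) (b : rat) : good a l ->
    \sum_(w | adj a w && (w \notin R)) (slope a w l + 1) <= b -> 0 <= b.
  move=> ga; apply: le_trans; apply: sumr_ge0 => w _; exact: slope_ge0.
(* compare the value at c with the threshold set by the value at u *)
have [jl|lj] := ltP (slope u c (i u)) (i c)%:R.
  have [gc le] := leaf_bound c_neq_u par_c uR onlyc gu jl.
  rewrite [E c _ _](st _ _ _ cR gc le) ?epsc ?mul0r ?mulr0 //.
  by rewrite -(ler0z rat); exact: nonneg le.
have le : \sum_(w | adj u w && (w \notin R)) (slope u w (i u) + 1) <=
    (cst u + e u * (i u)%:Z - (i c)%:Z)%:~R.
  have uy := y_gt0 u.
  rewrite intrB intrD intrM cstE.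
  have := x_large u; have := y_root.
  rewrite !(sum_split _ auc cR onlyu).
  have -> : \sum_(w | adj u w && (w \notin R)) (slope u w (i u) + 1) =
      \sum_(w | adj u w && (w \notin R)) (x w + 1)
      - \sum_(w | adj u w && (w \notin R)) rh w
      + (\sum_(w | adj u w && (w \notin R)) y w) *
        ((rh u + (i u)%:R - x u) / y u).
    rewrite mulr_suml -sumrB -big_split /=; apply: eq_bigr => w _.
    by rewrite /slope; field; rewrite gt_eqF.
  move: lj; rewrite /slope.
  set Y := \sum_(w | _) y w; set X := \sum_(w | _) (x w + 1).
  set Hh := \sum_(w | _) rh w => lj yu xu.
  set D := rh u + (i u)%:R - x u in lj *.
  have D0 : 0 <= D by rewrite subr_ge0.
  have : Y * (D / y u) <= ((e u)%:~R * y u - y c) * (D / y u).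
    by apply: ler_wpM2r; [rewrite divr_ge0 // ltW | lra].
  have -> : ((e u)%:~R * y u - y c) * (D / y u) =
      (e u)%:~R * D - y c / y u * D by field; rewrite gt_eqF.
  move: lj; rewrite !pmulrn /D !mulrBr !mulrDr !pmulrn; move: (Y * _) => Z; lra.
rewrite [E u _ _](st _ _ _ uR gu le) ?epsu ?mul0r //.
by rewrite -(ler0z rat); exact: nonneg le.
Qed.

(** The vertices a and b witness that the product of the limits vanishes on either
side of the edge; when a witness is summed out, its parent takes over. *)
Lemma sum_term_eq0 n (R : {set V}) E eps a b : #|R| = n ->
  u \in R -> c \in R -> (forall w, w \in R -> w != u -> par w \in R) ->
  (forall w l, w \in R -> causal (E w l)) ->
  (forall l m, ~~ good u l -> E u l m = 0) ->
  stable R E eps ->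
  a \in R -> side a -> eps a = 0 ->
  b \in R -> ~~ side b -> eps b = 0 ->
  (forall i : V -> nat, (forall w, w \notin R -> i w = 0%N) ->
     term R E i != 0 -> forall w, (i w <= B)%N) ->
  \sum_(i : {ffun V -> 'I_B.+1} | supported R i) term R E (fun w => i w) = 0.
Proof.
elim: n R E eps a b => [|n IHn] R E eps a b Rn uR cR parR cE Ebad st
    aR sa ea bR sb eb bnd.
  by move: uR; rewrite (cards0_eq Rn) inE.
case: (pickP [pred w in R | (w != u) && (w != c)]) => [v0 v0P|Ruc]; last first.
  have Ruc' w : w \in R -> w = u \/ w = c.
    move=> wR; have := Ruc w; rewrite /= wR /=.
    by case: eqP => [->|_] /=; [left | case: eqP => // ->; right].
  rewrite big1 // => i /supportedP si; apply: (term_edge_eq0 (eps := eps)) => //.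
    by case: (Ruc' b bR) eb sb => -> // _; rewrite side_c.
  by case: (Ruc' a aR) ea sa => -> // _; rewrite (negPf side_u).
(* a vertex furthest from u is a leaf of the tree spanned by R *)
case: (arg_maxnP d v0P) => v /= /andP[vR /andP[vu vc]] vmax.
have only w : adj v w -> w \in R -> w = par v.
  case/adjE=> [[//]|[wu wv]] wR; have := d_par wu; rewrite wv => dvw.
  have wc : w != c by apply/eqP=> h; move: vu; rewrite -wv h par_c eqxx.
  have := vmax w; rewrite /= wR wu wc => /(_ isT); by rewrite leqNgt dvw.
have parv := parR v vR vu.
have pv : par v != v by apply/eqP=> h; have := d_par vu; rewrite h ltnn.
rewrite (sum_supported (term R E) vR).
rewrite -(eq_bigr _ (fun i (si : supported (R :\ v) i) =>
  term_merge_sum cR parR vR vu vc only cE bnd (elimT (supportedP _ _) si))).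
pose eps' w := if w == par v then eps (par v) * eps v else eps w.
pose mv z := if z == v then par v else z.
have mvR z : z \in R -> mv z \in R :\ v.
  by rewrite /mv !inE; case: (eqVneq z v) => [_|zv] zR; rewrite ?pv ?zv ?parv ?zR.
have mvside z : side (mv z) = side z.
  by rewrite /mv; case: eqP => // ->; exact: side_par.
have mveps z : eps z = 0 -> eps' (mv z) = 0.
  rewrite /mv /eps'; case: (eqVneq z v) => [zv|_] ez.
    by rewrite eqxx -zv ez mulr0.
  by case: eqP ez => // ->  ->; rewrite mul0r.
(* mv moves a witness at v to the parent of v *)
apply: (IHn _ _ eps' (mv a) (mv b)); rewrite ?mvR ?mvside ?mveps //.
- by move: Rn; rewrite (cardsD1 v) vR add1n => -[].
- by rewrite !inE eq_sym vu.
- by rewrite !inE eq_sym vc.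
- move=> w /setD1P[wv wR] wu; rewrite !inE parR // andbT.
  apply/eqP=> h; have wpv : w = par v by apply: only => //; rewrite adj_sym -h adj_par.
  have := d_par wu; have := d_par vu; rewrite h -wpv => vw /(ltn_trans vw).
  by rewrite ltnn.
- move=> w l wR. exact: (causal_merge parR vR vu cE l wR).
- move=> l m gl; rewrite /merge; case: eqP => [up|_]; last exact: Ebad.
  rewrite -up /conv big1 // => j _.
  by rewrite /diff !Ebad // subrr mul0r.
- exact: (stable_merge parR vR vu only cE st).
- by move=> i; exact: (bounded_merge cR parR vR vu vc only cE bnd).
Qed.

(** The starting point of the pruning is the sequence equal to [phi v l] on the
natural numbers and to 0 elsewhere. *)
Lemma weighted_sum_eq0 (phi : V -> nat -> int) (eps : V -> int) a b :
  (forall v l, good v l -> phi v l = eps v) ->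
  (forall l, ~~ good u l -> phi u l = 0) ->
  side a -> eps a = 0 -> ~~ side b -> eps b = 0 ->
  let F (i : V -> nat) := \prod_v (phi v (i v) *
    binom_coefz (#|[set w | adj v w]|%:Z - 2) (dualc i v)) in
  (forall i, F i != 0 -> forall v, (i v <= B)%N) ->
  \sum_(i : {ffun V -> 'I_B.+1}) F (fun v => i v) = 0.
Proof.
move=> phiE phi_bad sa ea sb eb F bnd.
pose E v l (m : int) : int := phi v l * (0 <= m)%R%:R.
have FE i : term [set: V] E i = F i.
  rewrite /term; apply: eq_big => [v|v _]; first by rewrite inE.
  have [k dk] : exists k, #|[set w | adj v w]| = k.+1.
    suff /card_gt0P : exists w, w \in [set w | adj v w].
      by case: #|_| => // k _; exists k.
    have [->|vu] := eqVneq v u; last by exists (par v); rewrite inE adj_par.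
    by exists c; rewrite inE adj_sym -par_c adj_par.
  have -> : degin [set: V] v = k.+1.
    by rewrite -dk; apply: eq_card => w; rewrite !inE.
  by rewrite dk iter_diff_step.
under eq_bigr do rewrite -FE.
rewrite -[RHS](@sum_term_eq0 #|V| [set: V] E eps a b); rewrite ?inE ?cardsT //.
- apply: eq_bigl => i; apply/esym/supportedP => w.
  by rewrite inE.
- by move=> w l _ m; rewrite ltNge /E => /negPf->; rewrite mulr0.
- by move=> l m /phi_bad; rewrite /E => ->; rewrite mul0r.
- by move=> w l m _ gl _ m0; rewrite /E m0 mulr1 phiE.
- by move=> i _; rewrite FE; exact: bnd.
Qed.

End Peel.

(** * Rooted trees and the orbifold graph *)

Section Rooting.
Variables (V : finType) (T : plumbing_tree V) (r : V).

(** [par] is the parent function and [d] the distance to the root r, up to an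
additive constant; the root is its own parent. *)
Definition is_rooting (par : V -> V) (d : V -> nat) :=
  [/\ par r = r,
      forall v, v != r -> adj T v (par v),
      forall v, v != r -> d v = (d (par v)).+1 &
      forall v w, adj T v w ->
        (v != r /\ par v = w) \/ (w != r /\ par w = v)].

(** Two neighbours of v joined by a path avoiding v would close a cycle through v. *)
Lemma neighbours_separated v w1 w2 : adj T v w1 -> adj T v w2 ->
  connect [rel a b | [&& adj T a b, a != v & b != v]] w1 w2 -> w1 = w2.
Proof.
move=> vw1 vw2 /connectP[p0 p0P p0l].
case/shortenP: p0P p0l => p pP pu _ pl.
apply: contra_eq (isT : true) => w12.
have vw v' : adj T v v' -> v' != v.
  by move=> h; apply/eqP=> e; move: h; rewrite e adj_irr.
have vp : v \notin w1 :: p.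
  rewrite inE negb_or eq_sym vw //=.
  elim: p w1 pP {pu pl w12 vw1} => [|a p IHp] w //=.
  case/andP=> /and3P[_ _ av] /IHp.
  by rewrite inE negb_or eq_sym av.
have sz : (2 < size (v :: w1 :: p))%N.
  by case: p pl {pP pu vp} w12 => //= ->; rewrite eqxx.
have := tree_acyclic T sz; rewrite /ucycleb /= rcons_path vw1 -pl adj_sym vw2.
rewrite [path _ _ _](sub_path _ pP) /=; last by move=> a b /and3P[].
by move: pu => /= ->; rewrite vp.
Qed.

Let dist_ex v : exists n, [exists t : n.-tuple V,
  path (adj T) r t && (last r t == v)].
Proof.
case/connectP: (tree_connected T r v) => p pP pl.
by exists (size p); apply/existsP; exists (in_tuple p); rewrite /= pP pl eqxx.
Qed.

Let dist v := ex_minn (dist_ex v).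

Let dist_le v p : path (adj T) r p -> last r p = v -> (dist v <= size p)%N.
Proof.
move=> pP pl; rewrite /dist; case: ex_minnP => n _; apply.
by apply/existsP; exists (in_tuple p); rewrite /= pP pl eqxx.
Qed.

Let dist_path v : exists p, [/\ path (adj T) r p, last r p = v & size p = dist v].
Proof.
rewrite /dist; case: ex_minnP => n /existsP[t /andP[tP /eqP tl]] _.
by exists t; rewrite size_tuple.
Qed.

Let dist_adj v w : adj T v w -> (dist w <= (dist v).+1)%N.
Proof.
move=> vw; have [p [pP pl <-]] := dist_path v.
rewrite -(size_rcons p w); apply: dist_le; last by rewrite last_rcons.
by rewrite rcons_path pP pl.
Qed.

Let dist_pred v : v != r -> exists2 w, adj T v w & dist v = (dist w).+1.
Proof.
move=> vr; have [p] := dist_path v; case/lastP: p => [|p w] [].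
  by move=> _ /= rv; rewrite rv eqxx in vr.
rewrite rcons_path last_rcons size_rcons => /andP[pP lw] wv sp.
exists (last r p); first by rewrite -wv adj_sym.
apply/eqP; rewrite eqn_leq -{2}sp ltnS dist_le // andbT.
by apply: dist_adj; rewrite -wv.
Qed.

(** A shortest path from w to r avoids v if v is at least as far from r as w, and
v is not w. *)
Let connect_root v w : w != v -> (dist w <= dist v)%N ->
  connect [rel a b | [&& adj T a b, a != v & b != v]] w r.
Proof.
move: {2}(dist w) (leqnn (dist w)) => n.
elim: n w => [|n IHn] w wn wv dwv.
  have [->|/dist_pred[w' _ dw]] := eqVneq w r; first exact: connect0.
  by rewrite dw in wn.
have [->|/dist_pred[w' ww' dw]] := eqVneq w r; first exact: connect0.
have w'v : w' != v by apply: contraTneq dwv => <-; rewrite dw ltnn.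
apply: connect_trans (connect1 _) (IHn w' _ w'v _); rewrite /= ?ww' ?wv //.
  by move: wn; rewrite dw.
by apply: leq_trans dwv; rewrite dw.
Qed.

Let lower_unique v w1 w2 : adj T v w1 -> adj T v w2 ->
  (dist w1 <= dist v)%N -> (dist w2 <= dist v)%N -> w1 = w2.
Proof.
move=> vw1 vw2 l1 l2.
have vw v' : adj T v v' -> v' != v.
  by move=> h; apply/eqP=> e; move: h; rewrite e adj_irr.
apply: (neighbours_separated vw1 vw2).
apply: connect_trans (connect_root (vw _ vw1) l1) _.
rewrite (sym_connect_sym _) => [|a b /=]; last first.
  by rewrite adj_sym [(b != v) && _]andbC.
exact: connect_root (vw _ vw2) l2.
Qed.

Lemma rooting_exists : exists par d, is_rooting par d.
Proof.
pose par v := if v == r then r else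
  odflt r [pick w | adj T v w && (dist v == (dist w).+1)].
have parP v : v != r -> adj T v (par v) /\ dist v = (dist (par v)).+1.
  move=> vr; rewrite /par (negPf vr); case: pickP => [w /andP[? /eqP]//|no].
  by have [w vw dw] := dist_pred vr; have := no w; rewrite vw dw eqxx.
exists par, dist; split.
- by rewrite /par eqxx.
- by move=> v /parP[].
- by move=> v /parP[].
move=> v w.
wlog le : v w / (dist w <= dist v)%N.
  move=> wl vw; have [/wl|/ltnW/wl] := leqP (dist w) (dist v); first exact.
  by rewrite adj_sym => /(_ vw)[]; [right|left].
move=> vw; left; have vr : v != r.
  apply: contraTneq le => vr; rewrite -ltnNge.
  have wr : w != r by apply: contraTneq vw => ->; rewrite vr adj_irr.
  have [p []] := dist_path r; have := @dist_le r [::] isT erefl.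
  by rewrite vr leqn0 => /eqP -> _ _ _; have [? _ ->] := dist_pred wr.
split=> //; have [vp dp] := parP v vr.
by apply: lower_unique vp vw _ le; rewrite dp.
Qed.

End Rooting.

Section Orbifold.
Variables (V : finType) (T : plumbing_tree V) (r : V).
Variables (par : V -> V) (d : V -> nat).
Hypothesis rooted : is_rooting T r par d.
Hypothesis rN : r \in nodes T.

Let par_r : par r = r. Proof. by case: rooted. Qed.
Let adj_par v : v != r -> adj T v (par v). Proof. by case: rooted => _ + _ _; apply. Qed.
Let d_par v : v != r -> d v = (d (par v)).+1. Proof. by case: rooted => _ _ + _; apply. Qed.
Let adjE v w : adj T v w -> (v != r /\ par v = w) \/ (w != r /\ par w = v).
Proof. by case: rooted => _ _ _; apply. Qed.

Lemma iter_par_root v : iter (d v) par v = r.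
Proof.
move: {1 3}(d v) (erefl (d v)) => n; elim: n v => [|n IHn] v dv /=.
  by apply/eqP; apply: contraT => /d_par; rewrite -dv.
have [vr|vr] := eqVneq v r; first by rewrite vr -iterS iter_fix.
by rewrite -iterS iterSr IHn //; move: dv; rewrite (d_par vr) => -[].
Qed.

(** a lies on the path from v to the root; v is an ancestor of itself. *)
Definition anc (a v : V) : bool := `[< exists k, iter k par v = a >].

Lemma anc_refl v : anc v v. Proof. by apply/asboolP; exists 0%N. Qed.

Lemma anc_par a v : v != a -> anc a (par v) = anc a v.
Proof.
move=> va; apply/asboolP/asboolP => [[k <-]|[[|k] kv]].
- by exists k.+1; rewrite iterSr.
- by rewrite -kv eqxx in va.
- by exists k; rewrite -iterSr.
Qed.

Lemma d_par_le v : (d (par v) <= d v)%N.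
Proof. by have [->|/d_par->//] := eqVneq v r; rewrite par_r. Qed.

Lemma d_anc a v : anc a v -> (d a <= d v)%N.
Proof.
case/asboolP=> k <-; elim: k => //= k; exact/leq_trans/d_par_le.
Qed.

Lemma anc_eq a v : anc a v -> (d v <= d a)%N -> a = v.
Proof.
have [->|va] := eqVneq v a => //; rewrite -anc_par //.
have [->|vr] := eqVneq v r.
  by rewrite par_r => /asboolP[k <-] _; rewrite iter_fix.
by move=> av dv; have := leq_trans dv (d_anc av); rewrite (d_par vr) ltnn.
Qed.

Lemma anc_child c : c != r -> ~~ anc c (par c).
Proof.
by move=> cr; apply/negP=> /d_anc; rewrite (d_par cr) ltnn.
Qed.

Let gap_ex v : exists k, iter k.+1 par v \in nodes T.
Proof. by exists (d v); rewrite /= iter_par_root par_r. Qed.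

(** The number of vertices strictly between v and the first node above it. *)
Definition gap v := ex_minn (gap_ex v).

(** The first node strictly above v. *)
Definition next_node v := iter (gap v).+1 par v.

(** The vertex just below that node on the way to v, possibly v itself. *)
Definition branch v := iter (gap v) par v.

Lemma next_node_in v : next_node v \in nodes T.
Proof. by rewrite /next_node /gap; case: ex_minnP. Qed.

Lemma par_branch v : par (branch v) = next_node v. Proof. by []. Qed.

Lemma gap_min v k : (0 < k <= gap v)%N -> iter k par v \notin nodes T.
Proof.
case: k => // k; rewrite /gap; case: ex_minnP => m _ min km.
by apply/negP=> /min; rewrite leqNgt (_ : k < m)%N.
Qed.

Lemma next_nodeE v k : iter k.+1 par v \in nodes T ->
  (forall i, (0 < i <= k)%N -> iter i par v \notin nodes T) ->
  next_node v = iter k.+1 par v.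
Proof.
move=> kN kmin; rewrite /next_node; congr (iter _.+1 par v).
apply/eqP; rewrite eqn_leq; apply/andP; split.
  by rewrite /gap; case: ex_minnP => m _ /(_ _ kN).
rewrite leqNgt; apply/negP=> gk; have := next_node_in v.
by apply/negP/kmin.
Qed.

Lemma branch_neq_root v : v != r -> branch v != r.
Proof.
move=> vr; rewrite /branch; case E : (gap v) => [|k] //=.
apply/eqP=> h; have := @gap_min v k.+1; rewrite E leqnn => /(_ isT).
by rewrite /= h rN.
Qed.

Lemma anc_branch v : anc (branch v) v.
Proof. by apply/asboolP; exists (gap v). Qed.

Lemma d_next_node v : v != r -> (d (next_node v) < d v)%N.
Proof.
move=> vr; rewrite -ltnS -par_branch -(d_par (branch_neq_root vr)) ltnS.
exact/d_anc/anc_branch.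
Qed.

Lemma valency_ge3 v a b c : a != b -> a != c -> b != c ->
  adj T v a -> adj T v b -> adj T v c -> v \in nodes T.
Proof.
move=> ab ac bc va vb vc; rewrite inE /valency.
have <- : #|[set a; b; c]| = 3%N.
  rewrite finset.setUC cardsU1 cards2 !inE ab negb_or ![c == _]eq_sym.
  by rewrite ac bc.
apply: subset_leq_card; apply/fintype.subsetP=> w.
by rewrite !inE -orbA => /or3P[] /eqP->.
Qed.

(** A vertex that is not a node has at most one child, since it also has a parent. *)
Lemma single_child a b w : w \notin nodes T -> a != r -> b != r ->
  par a = w -> par b = w -> a = b.
Proof.
move=> wN ar br aw bw; apply: contraNeq wN => ab.
have [->|wr] := eqVneq w r; first exact: rN.
have pw a' : a' != r -> par a' = w -> a' != par w.
  move=> a'r a'w; apply/eqP=> h; have := d_par a'r.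
  by rewrite a'w (d_par wr) -h => e; have := leqnn (d a'); rewrite {1}e ltnNge leqnSn.
apply: (@valency_ge3 w a b (par w)); rewrite ?pw ?adj_par //.
  by rewrite adj_sym -aw adj_par.
by rewrite adj_sym -bw adj_par.
Qed.

(** The vertices from the branch down to v, v excluded, are not nodes, so that
each of them has a single child. *)
Lemma node_below_branch v j : v != r -> j \in nodes T -> anc (branch v) j ->
  anc v j.
Proof.
move=> vr jN /asboolP[n]; rewrite /branch.
have := leqnn (gap v); move: {1 3}(gap v) => k.
elim: k n => [|k IHk] n kg /= nj; first by apply/asboolP; exists n.
have kN : iter k.+1 par v \notin nodes T by apply: gap_min.
case: n nj => [|n] nj; first by move: kN; rewrite /= -nj /= jN.
apply: (IHk n); first exact: ltnW.
have ne i z : par (iter i par z) \notin nodes T -> iter i par z != r.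
  by apply: contraNneq => ->; rewrite par_r.
have nj' : par (iter n par j) = iter k.+1 par v by [].
by apply: (@single_child _ _ (iter k.+1 par v)) => //; apply: ne; rewrite ?nj'.
Qed.

(** A path without interior nodes that starts upwards keeps going up: at a turn,
an interior vertex would have two children. *)
Lemma path_up s v w : path (adj T) v (rcons s w) -> uniq (v :: rcons s w) ->
  all [predC nodes T] s -> v != r -> par v = head w s ->
  exists2 k, iter k.+1 par v = w &
    forall i, (0 < i <= k)%N -> iter i par v \notin nodes T.
Proof.
elim: s v => [|a s IHs] v /=; first by exists 0%N => // -[].
move=> /andP[va sP] /andP[vs su] /andP[aN sN] vr pva.
have ar : a != r by apply: contraNneq aN => ->.
have ab : adj T a (head w s) by case: s sP {IHs vs su sN} => /= [|b s] /andP[].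
have hs : head w s \in rcons s w.
  by case: s {sP su IHs ab vs sN} => [|b s] /=; rewrite inE eqxx.
have [k kw kN] : exists2 k, iter k.+1 par a = w &
    forall i, (0 < i <= k)%N -> iter i par a \notin nodes T.
  apply: IHs => //; case/adjE: ab => [[]//|[br bp]].
  have e : head w s = v by apply: (@single_child _ _ a).
  by case/negP: vs; rewrite inE -e hs orbT.
exists k.+1; first by rewrite iterSr pva.
move=> [|[|i]] // ik; first by rewrite /= pva.
by rewrite iterSr pva; exact: kN.
Qed.

(** A path that starts downwards keeps going down, as it would otherwise return to
a vertex already visited. *)
Lemma path_down s v w : path (adj T) v (rcons s w) -> uniq (v :: rcons s w) ->
  head w s != r -> par (head w s) = v ->
  exists2 k, iter k.+1 par w = v &
    w != r /\ forall i, (0 < i <= k)%N -> iter i par w \in s.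
Proof.
elim: s v => [|a s IHs] v /=; first by exists 0%N => //; split=> // -[].
move=> /andP[va sP] /andP[vs su] ar pav.
have ab : adj T a (head w s) by case: s sP {IHs vs su} => /= [|b s] /andP[].
have hs : head w s \in rcons s w.
  by case: s {sP su IHs ab vs} => [|b s] /=; rewrite inE eqxx.
have [||k kw [wr kN]] := IHs a sP su.
- case/adjE: ab => [[_ pa]|[]//].
  by case/negP: vs; rewrite inE -pav pa hs orbT.
- case/adjE: ab => [[_ pa]|[]//].
  by case/negP: vs; rewrite inE -pav pa hs orbT.
exists k.+1; first by rewrite -pav -kw.
split=> // i /andP[i0]; rewrite leq_eqVlt => /orP[/eqP->|ik].
  by rewrite kw inE eqxx.
by rewrite inE kN ?orbT // i0.
Qed.

Lemma orb_adjE v w : orb_adj T v w ->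
  (v != r /\ next_node v = w) \/ (w != r /\ next_node w = v).
Proof.
case/and4P=> vN wN vw /asboolP[s [sP su sv]].
have sN : all [predC nodes T] s.
  by apply: sub_all sv => a /= /eqP va; rewrite inE va.
have : adj T v (head w s) by case: s sP {su sv sN} => /= [|b s] /andP[].
case/adjE=> [[vr pv]|[hr ph]].
  have [k kw kN] := path_up sP su sN vr pv.
  by left; split=> //; rewrite -kw; apply: next_nodeE => //; rewrite kw.
have [k kw [wr kN]] := path_down sP su hr ph.
right; split=> //; rewrite -kw; apply: next_nodeE; first by rewrite kw.
by move=> i /kN; apply: (allP sN).
Qed.

(** The interior vertices on the way up have valency at most 2 because they are
not nodes, and at least 2 because they have a parent and a child. *)
Lemma orb_adj_next v : v \in nodes T -> v != r -> orb_adj T v (next_node v).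
Proof.
move=> vN vr; rewrite /orb_adj vN next_node_in /=.
have dv := d_next_node vr.
have ne k : (k <= gap v)%N -> iter k par v != r.
  case: k => // k kg; apply: contraNneq (gap_min (k := k.+1) kg) => ->.
  exact: rN.
have dk k : (k <= (gap v).+1)%N -> (d (iter k par v) + k = d v)%N.
  elim: k => [|k IHk] kg /=; first by rewrite addn0.
  by rewrite -IHk ?(ltnW kg) // (d_par (ne k kg)) addSnnS.
apply/andP; split; first by apply: contraTneq dv => <-; rewrite ltnn.
have trE : rcons (traject par (par v) (gap v)) (next_node v) =
    traject par (par v) (gap v).+1.
  by rewrite trajectSr -iterSr.
apply/asboolP; exists (traject par (par v) (gap v)); rewrite trE.
have sub n : (n <= (gap v).+1)%N -> path (adj T) v (traject par (par v) n).
  elim: n => // n IHn ng; rewrite trajectSr rcons_path IHn ?(ltnW ng) //.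
  by rewrite last_traject -iterSr; apply: adj_par; apply: ne.
split; first exact: sub.
- rewrite -[_ && _]/(uniq (traject par v (gap v).+2)) looping_uniq /looping.
  apply/trajectP=> -[k kg e].
  have := dk k (ltnW kg); rewrite -e -{1}(dk (gap v).+1 (leqnn _)).
  by move/addnI=> gk; rewrite gk ltnn in kg.
apply/allP=> a /trajectP[k kg ->]; rewrite -iterSr.
have kr := ne k.+1 kg.
have := @gap_min v k.+1 kg; rewrite inE -ltnNge ltnS => v2.
rewrite eqn_leq v2 /valency.
have -> : 2%N = #|[set iter k par v; iter k.+2 par v]|.
  rewrite cards2; case: eqP => // e; have := dk k (leqW (ltnW kg)).
  rewrite e -[in RHS](dk k.+2 kg) => /addnI/eqP.
  by rewrite -addn2 -{1}[k]addn0 eqn_add2l.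
apply: subset_leq_card; apply/fintype.subsetP=> w; rewrite !inE.
case/orP=> /eqP->; last exact: adj_par.
by rewrite adj_sym; apply/adj_par/ne/ltnW.
Qed.

Lemma orb_edgesE :
  orb_edges T = [set [set v; next_node v] | v in nodes T :\ r].
Proof.
apply/setP=> e; apply/imsetP/imsetP=> [[[v w]]|[v /setD1P[vr vN] ->]].
  rewrite inE /= => vw ->; have /and4P[vN wN _ _] := vw.
  case: (orb_adjE vw) => -[nr <-].
    by exists v; rewrite // in_setD1 nr.
  by exists w; rewrite ?in_setD1 ?nr // finset.setUC.
by exists (v, next_node v); rewrite // inE; exact: orb_adj_next.
Qed.

Lemma orb_edge_inj :
  {in nodes T :\ r &, injective (fun v => [set v; next_node v])}.
Proof.
move=> v w /setD1P[vr _] /setD1P[wr _] /setP e.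
have := e v; have := e w; rewrite !inE !eqxx /= => ew ev.
move: ev; case: (eqVneq v w) => //= _ /esym/eqP vnw.
move: ew; case: (eqVneq w v) => //= _ /eqP wnv.
have := d_next_node vr; have := d_next_node wr.
rewrite -wnv -vnw => a b; have := ltn_trans a b; by rewrite ltnn.
Qed.

End Orbifold.

(** * Finite sums and products of formal series *)

Section FiniteSums.
Local Open Scope classical_set_scope.

(** A finitely supported sum whose support is enumerated by a finite type. *)
Lemma fsum_image (X : choiceType) (J : finType) (g : J -> X) (D : set X)
    (Q : pred J) (F : X -> int) :
  injective g -> (forall j, Q j -> D (g j)) ->
  (forall x, D x -> F x != 0 -> exists2 j, Q j & x = g j) ->
  \sum_(x \in D) F x = \sum_(j | Q j) F (g j).
Proof.
move=> gi QD DQ; rewrite (fsbigE [seq g j | j <- enum Q]).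
- rewrite big_map big_enum_cond /=.
  apply: eq_bigl => j; rewrite [j \in Q]unfold_in.
  by case Qj: (Q j) => //=; rewrite mem_set //; exact: QD.
- by rewrite map_inj_uniq // enum_uniq.
- by move=> x /= /mapP[j]; rewrite mem_enum => /QD Dj ->.
move=> x Dx xr; apply/eqP; apply: contraNT xr => /(DQ x Dx)[j Qj ->].
by apply: map_f; rewrite mem_enum.
Qed.

Lemma fsum_single (X : choiceType) (a : X) (D : set X) (F : X -> int) :
  D a -> (forall x, D x -> x != a -> F x = 0) -> \sum_(x \in D) F x = F a.
Proof.
move=> Da F0; rewrite (fsbigE [:: a]) //=.
- by rewrite big_cons big_nil ifT ?addr0 // inE.
- by move=> x /=; rewrite inE => /eqP->.
by move=> x Dx; rewrite inE; exact: F0.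
Qed.

Lemma fsum_fibres (X : choiceType) (J : finType) (q : J -> X)
    (F : J -> X -> int) :
  (forall j y, y != q j -> F j y = 0) ->
  \sum_(y \in [set: X]) \sum_j F j y = \sum_j F j (q j).
Proof.
move=> F0; rewrite (fsbigE (undup [seq q j | j <- enum J])) //.
- under eq_bigl do rewrite in_setT.
  rewrite exchange_big /=; apply: eq_bigr => j _.
  have qj : q j \in undup [seq q j | j <- enum J].
    by rewrite mem_undup map_f // mem_enum.
  rewrite (bigD1_seq (q j)) ?undup_uniq //= big1 ?addr0 // => y; exact: F0.
- exact: undup_uniq.
move=> y _ yq; apply: big1 => j _; apply: F0; apply: contraNneq yq => ->.
by rewrite mem_undup map_f // mem_enum.
Qed.

End FiniteSums.

Section FormalSeries.
Local Open Scope classical_set_scope.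
Variable G : zmodType.

Lemma smul_mono (g : G) (A : series G) x : smul (mono g) A x = A (x - g).
Proof.
rewrite /smul (fsum_single (a := g)) // /mono ?eqxx ?mul1r // => y _ /negPf->.
by rewrite mul0r.
Qed.

Lemma binom_seriesE (g : G) k n : (forall a b, g *+ a = g *+ b -> a = b) ->
  binom_series g k (g *+ n) = binom_coef k n.
Proof.
move=> gi; rewrite /binom_series (fsum_single (a := n)) // => m /= mn.
by rewrite (gi _ _ mn) eqxx.
Qed.

Lemma binom_series_supp (g : G) k x : binom_series g k x != 0 ->
  exists n, x = g *+ n.
Proof.
move=> nz; apply: contrapT => no; move/negP: nz; apply; apply/eqP.
by apply: fsbig1 => n /= nx; case: no; exists n.
Qed.

Section Products.
Variables (I : finType) (g : I -> G) (A : I -> series G) (a : I -> nat -> int).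

(** The exponent of the monomial with multiplicities n in the generators g. *)
Definition combi (s : seq I) (n : I -> nat) := \sum_(i <- s) g i *+ n i.

(** Monomials in the generators g indexed by s determine their multiplicities. *)
Definition indep (s : seq I) :=
  forall n m, combi s n = combi s m -> {in s, n =1 m}.

(** If each A i is a series in the single monomial of exponent g i, with
coefficients a i, and the g i are independent, then the product has a single
contribution to each coefficient.  No finiteness of the supports is needed. *)
Lemma big_smul_coef (s : seq I) : uniq s -> indep s ->
  (forall i n, i \in s -> A i (g i *+ n) = a i n) ->
  (forall i x, i \in s -> A i x != 0 -> exists n, x = g i *+ n) ->
  (forall n, (\big[@smul G/mono 0]_(i <- s) A i) (combi s n) =
             \prod_(i <- s) a i (n i)) /\
  (forall x, (\big[@smul G/mono 0]_(i <- s) A i) x != 0 ->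
             exists n, x = combi s n).
Proof.
elim: s => [|i s IHs] /=.
  move=> _ _ _ _; split=> [n|x]; rewrite /combi big_nil.
    by rewrite !big_nil /mono eqxx.
  rewrite /mono; case: (eqVneq x 0) => [->|_]; last by rewrite eqxx.
  by exists (fun=> 0%N); rewrite big_nil.
case/andP=> iNs us ind Ag Asupp.
have upd k n : combi (i :: s) (fun j => if j == i then k else n j) =
    g i *+ k + combi s n.
  rewrite /combi big_cons eqxx; congr (_ + _); apply: eq_big_seq => j js.
  by case: (eqVneq j i) js => [->|//]; rewrite (negPf iNs).
have ind' : indep s.
  move=> n m nm j js.
  have /ind /(_ j) : combi (i :: s) (fun j => if j == i then 0%N else n j) =
      combi (i :: s) (fun j => if j == i then 0%N else m j) by rewrite !upd nm.
  rewrite inE js orbT; case: (eqVneq j i) js => [->|_ _]; last exact.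
  by rewrite (negPf iNs).
have [||IH1 IH2] := IHs us ind'.
- by move=> j n js; apply: Ag; rewrite inE js orbT.
- by move=> j x js; apply: Asupp; rewrite inE js orbT.
set B := \big[_/_]_(j <- s) _ in IH1 IH2.
have i0 : i \in i :: s by rewrite inE eqxx.
split=> [n|x]; rewrite !big_cons -/B.
  rewrite /combi big_cons -/(combi s n) /smul (fsum_single (a := g i *+ n i)) //.
    by rewrite Ag // addrAC subrr add0r IH1.
  move=> y _ yn; apply/eqP; apply: contraNT yn; rewrite mulf_eq0 negb_or.
  case/andP=> /(Asupp _ _ i0)[k ->] /IH2[m e]; apply/eqP; congr (_ *+ _).
  have /ind /(_ i i0) : combi (i :: s) (fun j => if j == i then k else m j) =
      combi (i :: s) n by rewrite upd -e /combi big_cons addrC subrK.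
  by rewrite eqxx.
move=> nz; have [y nzy] : exists y, A i y * B (x - y) != 0.
  apply: contrapT => no; move/negP: nz; apply; apply/eqP; apply: fsbig1 => y _.
  by apply/eqP; apply: contrapT => /negP h; apply: no; exists y.
move: nzy; rewrite mulf_eq0 negb_or => /andP[/(Asupp _ _ i0)[k yk] /IH2[m e]].
exists (fun j => if j == i then k else m j).
by rewrite upd -e yk addrC subrK.
Qed.

Lemma sprod_coef (P : {pred I}) :
  (forall n m : I -> nat, \sum_(i in P) g i *+ n i = \sum_(i in P) g i *+ m i ->
     {in P, n =1 m}) ->
  (forall i n, i \in P -> A i (g i *+ n) = a i n) ->
  (forall i x, i \in P -> A i x != 0 -> exists n, x = g i *+ n) ->
  (forall n, sprod P A (\sum_(i in P) g i *+ n i) = \prod_(i in P) a i (n i)) /\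
  (forall x, sprod P A x != 0 -> exists n : I -> nat, x = \sum_(i in P) g i *+ n i).
Proof.
move=> ind Ag Asupp; pose s := [seq i <- index_enum I | i \in P].
have sP i : (i \in s) = (i \in P) by rewrite mem_filter mem_index_enum andbT.
have cE n : \sum_(i in P) g i *+ n i = combi s n by rewrite /combi big_filter.
have [||||H1 H2] := @big_smul_coef s.
- by rewrite filter_uniq // index_enum_uniq.
- by move=> n m; rewrite -!cE => /ind h i; rewrite sP; exact: h.
- by move=> i n; rewrite sP; exact: Ag.
- by move=> i x; rewrite sP; exact: Asupp.
split=> [n|x]; rewrite /sprod -big_filter.
  by rewrite cE H1 big_filter.
by move=> /H2[n ->]; exists n; rewrite cE.
Qed.

End Products.
End FormalSeries.

(** * Coordinates with respect to the dual basis *)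

Section DualCoordinates.
Variables (V : finType) (T : plumbing_tree V).

(** The coefficient of [Estar v] in l, see [coord_Estar]. *)
Definition dcoord (l : LQ V) (v : V) : rat := - Defs.form T l (Ebase v).

(** The opposite of the self-intersection of E_v. *)
Definition euler (v : V) : int := - decoration T v.

Lemma dcoordE l v :
  dcoord l v = (euler v)%:~R * l v - \sum_(w | adj T v w) l w.
Proof.
rewrite /dcoord form_Ebase (bigD1 v) //= opprD /euler intrN mulNr mulrC.
rewrite /pairing eqxx; congr (_ - _); rewrite big_mkcond [RHS]big_mkcond /=.
apply: eq_bigr => w _; case: (eqVneq w v) => [->|wv] /=.
  by rewrite adj_irr.
by rewrite adj_sym; case: (adj T v w); rewrite ?mulr1 ?mulr0.
Qed.

Lemma dcoord_Estar u v : dcoord (Estar T u) v = (u == v)%:R.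
Proof. by rewrite /dcoord Estar_valP opprK. Qed.

Lemma dcoord_inj l l' : dcoord l =1 dcoord l' -> l = l'.
Proof. by move=> e; apply: (@form_ext _ T) => w; apply/oppr_inj/e. Qed.

Lemma dcoord_sum (I : finType) (P : pred I) (a : I -> rat) (l : I -> LQ V) v :
  dcoord [ffun w => \sum_(i | P i) a i * l i w] v = \sum_(i | P i) a i * dcoord (l i) v.
Proof.
rewrite dcoordE ffunE mulr_sumr.
under [X in _ - X]eq_bigr do rewrite ffunE.
rewrite exchange_big -sumrB; apply: eq_bigr => i _ /=.
by rewrite dcoordE mulrBr mulr_sumr mulrCA.
Qed.

Lemma coord_Estar (l : LQ V) w : l w = \sum_v dcoord l v * Estar T v w.
Proof.
have {1}-> : l = [ffun w => \sum_v dcoord l v * (Estar T v : LQ V) w].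
  apply: dcoord_inj => v; rewrite dcoord_sum (bigD1 v) //= big1 ?addr0.
    by rewrite dcoord_Estar eqxx mulr1.
  by move=> u uv; rewrite dcoord_Estar (negPf uv) mulr0.
by rewrite ffunE.
Qed.

Lemma form_sum (y z : LQ V) : Defs.form T y z = - \sum_w z w * dcoord y w.
Proof.
rewrite -sumrN /Defs.form /form_of exchange_big; apply: eq_bigr => w _ /=.
rewrite /dcoord mulrN opprK form_Ebase mulr_sumr; apply: eq_bigr => v _.
by rewrite mulrAC mulrC mulrA.
Qed.

Lemma form_neg (z : LQ V) : z != 0 -> Defs.form T z z < 0.
Proof.
move=> z0; pose d : int := \prod_v denq (z v).
have d0 : d%:~R != 0 :> rat.
  by rewrite intr_eq0; apply/prodf_neq0=> j _; exact: denq_neq0.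
pose dz : LQ V := [ffun v => d%:~R * z v].
have dzL : dz \in @L_pred V.
  apply/forallP=> v; rewrite ffunE /d (bigD1 v) //= intrM mulrAC.
  by rewrite [X in X * _]mulrC -numqE -intrM intr_int.
have dz0 : dz != 0.
  apply: contra z0 => /eqP h; apply/eqP/ffunP=> v.
  have /eqP := congr1 (fun f : LQ V => f v) h.
  by rewrite !ffunE mulf_eq0 (negPf d0) => /eqP.
have := neg_def T dzL dz0.
have -> : form_of (adj T) (decoration T) dz dz = d%:~R ^+ 2 * Defs.form T z z.
  rewrite /Defs.form /form_of mulr_sumr; apply: eq_bigr => v _.
  by rewrite mulr_sumr; apply: eq_bigr => w _; rewrite !ffunE; ring.
by rewrite pmulr_rlt0 // exprn_even_gt0.
Qed.

(** The negative part z of y satisfies (z, z) >= 0, hence z = 0. *)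
Lemma coord_ge0 (y : LQ V) w : (forall v, 0 <= dcoord y v) -> 0 <= y w.
Proof.
move=> dy.
pose z : LQ V := [ffun v => Num.min (y v) 0].
have zE v : z v = Num.min (y v) 0 by rewrite ffunE.
have z_le0 v : z v <= 0 by rewrite zE ge_min lexx orbT.
have z_le v : z v <= y v by rewrite zE ge_min lexx.
have yz : 0 <= Defs.form T y z.
  rewrite form_sum oppr_ge0; apply: sumr_le0 => v _.
  by rewrite mulr_le0_ge0.
have pz : Defs.form T (y - z) z <= 0.
  rewrite /Defs.form /form_of; apply: sumr_le0 => v _; apply: sumr_le0 => w' _.
  rewrite /pairing !ffunE -!zE; case: (eqVneq v w') => [<-|_].
    suff -> : (y v - z v) * z v = 0 by rewrite mul0r.
    by rewrite zE /Num.min; case: ifP => _; rewrite ?subrr ?mul0r ?mulr0.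
  by rewrite mulr_le0_ge0 ?mulr_ge0_le0 ?subr_ge0 // ler0z; case: adj.
have z0 : z = 0.
  apply/eqP; apply: contraTT isT => /form_neg; rewrite ltNge.
  by case/negP; have := Defs.formB T y z z; lra.
by have := z_le w; rewrite z0 ffunE.
Qed.

Lemma Estar_ge0 u w : 0 <= Estar T u w.
Proof. by apply: coord_ge0 => v; rewrite dcoord_Estar ler0n. Qed.

(** A vanishing coordinate would propagate to the neighbours, and thus to u, where
the dual coordinate of [Estar u] is 1. *)
Lemma Estar_gt0 u w : 0 < Estar T u w.
Proof.
rewrite lt0r Estar_ge0 andbT; set y : LQ V := Estar T u.
apply/eqP=> yw.
have step v : y v = 0 -> v != u /\ forall v', adj T v v' -> y v' = 0.
  move=> yv; have := dcoordE y v; rewrite dcoord_Estar yv mulr0 add0r.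
  have s0 : 0 <= \sum_(v' | adj T v v') y v'.
    by apply: sumr_ge0 => v' _; exact: Estar_ge0.
  have [_ /= e|uv /= e] := eqVneq u v; first by exfalso; move: e s0; lra.
  split=> // v' vv'; have /eqP : \sum_(v' | adj T v v') y v' = 0 by lra.
  rewrite psumr_eq0 => [/allP/(_ v' (mem_index_enum _))|v2 _].
    by rewrite vv' => /eqP.
  exact: Estar_ge0.
case/connectP: (tree_connected T w u) => p; elim: p w yw => [|a p IHp] w yw /=.
  by move=> _ wu; have [] := step w yw; rewrite wu eqxx.
by case/andP=> wa; apply: IHp; have [_] := step w yw; apply.
Qed.

End DualCoordinates.

(** * The coefficients on one class of the dual lattice *)

Section Classes.
Variables (V : finType) (T : plumbing_tree V).

Lemma class_eq (a b : dual T) : (class a == class b) = (a - b \in @L_in_L' V T).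
Proof. by rewrite /class -Quotient.idealrBE. Qed.

Lemma class_diffP (a b : dual T) :
  reflect (forall v, a v - b v \is a Num.int) (class a == class b).
Proof.
rewrite class_eq unfold_in /L_in_L' -[dual_val (a - b)]/(val (a - b)) raddfB.
by apply: (iffP forallP) => h v; have := h v; rewrite !ffunE.
Qed.

Lemma classD : {morph @class V T : a b / a + b}.
Proof. by move=> a b; rewrite /class pi_addr. Qed.

Lemma class0 : class (0 : dual T) = 0.
Proof. by apply: (addrI (class 0)); rewrite -classD !addr0. Qed.

Lemma classMn (a : dual T) n : class (a *+ n) = class a *+ n.
Proof. by elim: n => [|n IHn]; rewrite ?mulr0n ?class0 // !mulrS classD IHn. Qed.

Lemma class_sum (n : V -> nat) :
  class (\sum_v Estar T v *+ n v) = \sum_v class (Estar T v) *+ n v.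
Proof.
by rewrite (big_morph _ classD class0); apply: eq_bigr => v _; rewrite classMn.
Qed.

Lemma sum_val (n : V -> nat) :
  dual_val (\sum_v Estar T v *+ n v) = \sum_v (Estar T v : LQ V) *+ n v.
Proof.
rewrite -[LHS]/(val _) raddf_sum; apply: eq_bigr => v _.
by rewrite raddfMn.
Qed.

Lemma L_sub_L' (z : LQ V) : z \in @L_pred V -> z \in L'_pred T.
Proof.
move=> /forallP zL; apply/forallP=> w; rewrite form_Ebase rpred_sum // => v _.
by rewrite rpredM // intr_int.
Qed.

Lemma ffun_sumMn (n : V -> nat) w :
  (\sum_v (Estar T v : LQ V) *+ n v) w = \sum_v (n v)%:R * Estar T v w.
Proof.
by rewrite sum_ffunE; apply: eq_bigr => v _; rewrite ffunMnE mulr_natl.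
Qed.

Lemma dcoord_sumMn (n : V -> nat) w :
  dcoord T (\sum_v (Estar T v : LQ V) *+ n v) w = (n w)%:R.
Proof.
have -> : \sum_v (Estar T v : LQ V) *+ n v =
    [ffun w => \sum_v (n v)%:R * (Estar T v : LQ V) w].
  by apply/ffunP=> u; rewrite ffun_sumMn ffunE.
rewrite dcoord_sum (bigD1 w) //= big1 ?addr0.
  by rewrite dcoord_Estar eqxx mulr1.
by move=> u uw; rewrite dcoord_Estar (negPf uw) mulr0.
Qed.

End Classes.

(** lh is the representative with coordinates in [0, 1) of the class h. *)
Section Support.
Variables (V : finType) (T : plumbing_tree V) (lh : dual T) (h : H T).
Hypothesis lh_class : class lh = h.
Hypothesis lh_itv : forall v, 0 <= lh v < 1.

Definition intvec (i : V -> nat) : LQ V := [ffun v => (i v)%:R].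

Lemma intvec_in_L' i : intvec i \in L'_pred T.
Proof. by apply/L_sub_L'/forallP => v; rewrite ffunE rpred_nat. Qed.

(** The candidates for the elements of the class h with nonnegative coordinates. *)
Definition point (i : V -> nat) : dual T := lh + Dual (intvec_in_L' i).

Lemma pointE i v : point i v = lh v + (i v)%:R.
Proof. by rewrite /point -[dual_val _]/(val _) raddfD /= !ffunE. Qed.

Lemma point_class i : class (point i) = h.
Proof.
rewrite -lh_class; apply/eqP/class_diffP => v.
by rewrite pointE addrAC subrr add0r rpred_nat.
Qed.

(** The dual coordinate of lh, which is an integer. *)
Definition cst (v : V) : int := Num.floor (dcoord T lh v).

Lemma cst_dcoord v : (cst v)%:~R = dcoord T lh v.
Proof.
apply: floorK; rewrite /dcoord rpredN.
by case: lh => l /= /forallP; apply.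
Qed.

Lemma cstE v : (cst v)%:~R =
  (euler T v)%:~R * lh v - \sum_(w | adj T v w) lh w.
Proof. by rewrite cst_dcoord dcoordE. Qed.

Let dualcT := dualc (adj T) (euler T) cst.

Lemma dcoord_point i v : dcoord T (point i) v = (dualcT i v)%:~R.
Proof.
have -> : dcoord T (point i) v = (euler T v)%:~R * (lh v + (i v)%:Z%:~R) -
    (\sum_(w | adj T v w) lh w + \sum_(w | adj T v w) (i w)%:Z%:~R).
  rewrite dcoordE pointE -big_split; congr (_ - _).
  by apply: eq_bigr => w _; exact: pointE.
by rewrite /dualcT /dualc intrB intrD intrM cstE [(\sum_(w | _) _%:Z)%:~R]raddf_sum /=; ring.
Qed.

(** The coefficient of the point lh + i in the series, see [pser_point] and
[f_point]. *)
Definition weight (i : V -> nat) : int :=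
  \prod_v binom_coefz ((valency T v)%:Z - 2) (dualcT i v).

Lemma weight_ge0 i v : weight i != 0 -> 0 <= dualcT i v.
Proof.
move=> /prodf_neq0 /(_ v isT); by case: (dualcT i v).
Qed.

Lemma point_sum i : (forall v, 0 <= dualcT i v) ->
  point i = \sum_v Estar T v *+ `|dualcT i v|%N.
Proof.
move=> pos; apply: val_inj; apply: (@dcoord_inj _ T) => v.
rewrite dcoord_point -[val _]/(dual_val _) sum_val dcoord_sumMn.
by rewrite -{1}[dualcT i v]gez0_abs.
Qed.

Lemma Estar_indep (n m : V -> nat) :
  \sum_v (Estar T v : LQ V) *+ n v = \sum_v (Estar T v : LQ V) *+ m v -> n =1 m.
Proof.
move=> e v; have := dcoord_sumMn T n v; rewrite e dcoord_sumMn.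
by move/eqP; rewrite eqr_nat => /eqP.
Qed.

Lemma Estar_free v a b : (Estar T v : LQ V) *+ a = (Estar T v : LQ V) *+ b -> a = b.
Proof.
move=> /(congr1 (fun l : LQ V => l v)).
by rewrite !ffunMnE => /mulrIn; apply; rewrite gt_eqF ?Estar_gt0.
Qed.

Lemma pser_coef :
  (forall n : V -> nat, pser T (\sum_v (Estar T v : LQ V) *+ n v) =
     \prod_v binom_coef ((valency T v)%:Z - 2) (n v)) /\
  (forall l, pser T l != 0 ->
     exists n : V -> nat, l = \sum_v (Estar T v : LQ V) *+ n v).
Proof.
apply: (@sprod_coef _ _ (fun v => Estar T v : LQ V)
  (fun v => binom_series (Estar T v : LQ V) ((valency T v)%:Z - 2))
  (fun v => binom_coef ((valency T v)%:Z - 2)) predT).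
- by move=> n m /Estar_indep nm v _; exact: nm.
- by move=> v n _; apply: binom_seriesE; exact: Estar_free.
- by move=> v l _; exact: binom_series_supp.
Qed.

(** The exponents of the factors of the equivariant series. *)
Let eqgen v : H T * LQ V := (class (Estar T v), Estar T v : LQ V).

Lemma eqgen_sum (n : V -> nat) : \sum_v eqgen v *+ n v =
  (class (\sum_v Estar T v *+ n v), \sum_v (Estar T v : LQ V) *+ n v).
Proof.
have pM (a : H T) (b : LQ V) k : (a, b) *+ k = (a *+ k, b *+ k).
  by elim: k => // k IHk; rewrite !mulrS IHk.
rewrite class_sum; elim: (index_enum V) => [|v s IHs]; first by rewrite !big_nil.
by rewrite !big_cons IHs /eqgen pM.
Qed.

Lemma equivariant_coef :
  (forall n : V -> nat, @equivariant_ser V T (\sum_v eqgen v *+ n v) =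
     \prod_v binom_coef ((valency T v)%:Z - 2) (n v)) /\
  (forall l, @equivariant_ser V T l != 0 ->
     exists n : V -> nat, l = \sum_v eqgen v *+ n v).
Proof.
have indep (n m : V -> nat) :
    \sum_v eqgen v *+ n v = \sum_v eqgen v *+ m v -> n =1 m.
  by rewrite !eqgen_sum => -[_]; exact: Estar_indep.
apply: (@sprod_coef _ _ eqgen
  (fun v => binom_series (eqgen v) ((valency T v)%:Z - 2))
  (fun v => binom_coef ((valency T v)%:Z - 2)) predT).
- by move=> n m /indep nm v _; exact: nm.
- move=> v n _; apply: binom_seriesE => a b ab.
  have /indep /(_ v) : \sum_w eqgen w *+ (if w == v then a else 0%N) =
      \sum_w eqgen w *+ (if w == v then b else 0%N).
    rewrite (bigD1 v) //= [RHS](bigD1 v) //= eqxx ab; congr (_ + _).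
    by apply: eq_bigr => w /negPf->.
  by rewrite eqxx.
- by move=> v l _; exact: binom_series_supp.
Qed.

Lemma prod_abs_dualc i : (forall v, 0 <= dualcT i v) ->
  \prod_v binom_coef ((valency T v)%:Z - 2) `|dualcT i v|%N = weight i.
Proof.
by move=> pos; apply: eq_bigr => v _; have := pos v; case: (dualcT i v).
Qed.

Lemma weight_neg i : ~ (forall v, 0 <= dualcT i v) -> weight i = 0.
Proof.
by move=> npos; apply/eqP; apply: contra_notT npos => nz v; exact: weight_ge0.
Qed.

Lemma nonneg_of_sum i (n : V -> nat) :
  point i = \sum_v (Estar T v : LQ V) *+ n v :> LQ V ->
  forall v, 0 <= dualcT i v.
Proof.
move=> e v; rewrite -(ler0z rat) -dcoord_point e dcoord_sumMn.
exact: ler0n.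
Qed.

Lemma pser_point i : pser T (point i) = weight i.
Proof.
have [C1 C2] := pser_coef.
have [pos|npos] := pselect (forall v, 0 <= dualcT i v).
  by rewrite point_sum // sum_val C1 prod_abs_dualc.
rewrite weight_neg //; apply/eqP; apply: contra_notT npos => /C2[n].
exact: nonneg_of_sum.
Qed.

Lemma f_point i : f_ h (point i : LQ V) = weight i.
Proof.
have [C1 C2] := equivariant_coef; rewrite /f_.
have [pos|npos] := pselect (forall v, 0 <= dualcT i v).
  rewrite -(point_class i) point_sum // sum_val -eqgen_sum C1.
  exact: prod_abs_dualc.
rewrite weight_neg //; apply/eqP; apply: contra_notT npos => /C2[n].
by rewrite eqgen_sum => -[_]; exact: nonneg_of_sum.
Qed.

Lemma point_of_nonneg (l : dual T) : class l = h -> (forall v, 0 <= l v) ->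
  exists i, l = point i.
Proof.
rewrite -lh_class => /eqP/class_diffP lint lge0.
exists (fun v => `|Num.floor (l v - lh v)|%N); apply: val_inj.
apply/ffunP=> v; rewrite -[val _]/(dual_val _) -[val _]/(dual_val _) pointE.
have := lint v; move/floorK => e; have /andP[h0 h1] := lh_itv v.
have f0 : 0 <= Num.floor (l v - lh v).
  rewrite -[_ <= _]ltzD1 -(ltr_int rat) intrD e.
  by have := lge0 v; lra.
by rewrite -[X in _ = _ + X]/(`|Num.floor (l v - lh v)|%:Z%:~R) gez0_abs // e; lra.
Qed.

Lemma sum_Estar_ge0 (n : V -> nat) v : 0 <= (\sum_v Estar T v *+ n v : dual T) v.
Proof.
by apply: (@coord_ge0 _ T) => w; rewrite sum_val dcoord_sumMn ler0n.
Qed.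

Lemma pser_supp (l : dual T) : class l = h -> pser T l != 0 ->
  exists2 i, l = point i & weight i != 0.
Proof.
move=> lcl nz; have [_ /(_ _ nz)[n ln]] := pser_coef.
have [|i li] := point_of_nonneg lcl.
  by move=> v; rewrite ln -sum_val; exact: sum_Estar_ge0.
by exists i; rewrite // -pser_point -li.
Qed.

Lemma f_supp (l : LQ V) : f_ h l != 0 ->
  exists2 i, l = point i & weight i != 0.
Proof.
move=> nz; have [_ /(_ _ nz)[n]] := equivariant_coef; rewrite eqgen_sum => -[hn ln].
have [|i li] := point_of_nonneg (esym hn); first exact: sum_Estar_ge0.
have li' : l = point i by rewrite -li sum_val.
by exists i; rewrite // -f_point -li'.
Qed.

(** All coordinates of a nonnegative combination of the Estar u are bounded by a
multiple of any single one, because the ratios of the coordinates of each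
Estar u are bounded. *)
Lemma weight_bounded (x : LQ V) : exists B : nat, forall i v,
  weight i != 0 -> point i v < x v -> forall w, (i w <= B)%N.
Proof.
pose K : rat := \sum_u \sum_v \sum_w Estar T u w / Estar T u v.
pose M : rat := \sum_v `|x v|.
exists `|Num.ceil (K * M)|%N => i v nz iv w.
have r0 u v' w' : 0 <= Estar T u w' / Estar T u v'.
  by rewrite divr_ge0 // Estar_ge0.
have K0 : 0 <= K by do 3!apply: sumr_ge0 => ? _.
have rK u : Estar T u w / Estar T u v <= K.
  rewrite /K (bigD1 u) //= (bigD1 v) //= (bigD1 w) //= -!addrA lerDl.
  by rewrite !addr_ge0 //; do ?[apply: sumr_ge0 => ? _]; exact: r0.
have xM : x v <= M.
  rewrite /M (bigD1 v) //= (le_trans (ler_norm _)) // lerDl.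
  by apply: sumr_ge0.
have le : point i w <= K * M.
  apply: le_trans (_ : K * point i v <= _); last first.
    by apply: ler_wpM2l => //; apply/ltW/(lt_le_trans iv).
  rewrite (coord_Estar T (point i) w) (coord_Estar T (point i) v) mulr_sumr.
  apply: ler_sum => u _; rewrite mulrCA ler_wpM2l //.
    by rewrite dcoord_point ler0z weight_ge0.
  by rewrite -ler_pdivrMr ?Estar_gt0.
rewrite -(ler_nat rat); have /andP[h0 _] := lh_itv w.
apply: le_trans (_ : point i w <= _); first by rewrite pointE lerDr.
apply: le_trans le _; apply: le_trans (ceil_ge _) _.
by rewrite -[X in _ <= X]/(_%:Z%:~R) ler_int lez_abs.
Qed.

End Support.

(** * The two sides of the formula as sums over a finite box *)

Section Counting.
Variables (V : finType) (T : plumbing_tree V).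
Local Open Scope classical_set_scope.

(** The series of the product over i in I of t_i / (1 - t_i). *)
Definition orthant (I : {set V}) : series (LQ V) :=
  sprod (mem I) (fun i =>
    smul (mono (restr I (Ebase i))) (binom_series (restr I (Ebase i)) (-1))).

Lemma restr_Ebase_sum (I : {set V}) (n : V -> nat) v :
  (\sum_(i in I) restr I (Ebase i) *+ n i) v = if v \in I then (n v)%:R else 0.
Proof.
rewrite sum_ffunE; case: ifP => vI.
  rewrite (bigD1 v) //= ffunMnE !ffunE vI eqxx big1 ?addr0 // => i /andP[_ iv].
  by rewrite ffunMnE !ffunE vI (negPf iv) mul0rn.
by rewrite big1 // => i _; rewrite ffunMnE !ffunE vI mul0rn.
Qed.

Lemma orthantE (I : {set V}) (z : LQ V) :
  orthant I z = `[< (forall v, v \notin I -> z v = 0) /\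
                    (forall v, v \in I -> z v \is a Num.int /\ 0 < z v) >]%:R.
Proof.
pose g i : LQ V := restr I (Ebase i).
have gI i v : i \in I -> g i v = (i == v)%:R.
  by move=> iI; rewrite !ffunE; case: ifP => // vI; case: eqP vI => // <-; rewrite iI.
have gfree i a b : i \in I -> g i *+ a = g i *+ b -> a = b.
  move=> iI /(congr1 (fun f : LQ V => f i)); rewrite !ffunMnE gI // eqxx.
  by move/eqP; rewrite eqr_nat => /eqP.
have [||| C1 C2] := @sprod_coef (LQ V) V g
    (fun i => smul (mono (g i)) (binom_series (g i) (-1)))
    (fun _ n => (0 < n)%N%:R) (mem I).
- move=> n m e v vI; have := congr1 (fun f : LQ V => f v) e.
  by rewrite !restr_Ebase_sum vI => /eqP; rewrite eqr_nat => /eqP.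
- move=> i [|n] iI; rewrite smul_mono.
    rewrite mulr0n sub0r; apply/eqP; apply: contraT => /binom_series_supp[k].
    move/(congr1 (fun f : LQ V => f i)); rewrite ffunMnE ffunE gI // eqxx => h.
    by have := ler0n rat k; rewrite -h oppr_ge0 ler10.
  rewrite mulrS addrAC subrr add0r binom_seriesE; last by move=> a b; exact: gfree.
  by rewrite /= binn.
- move=> i y iI; rewrite smul_mono => /binom_series_supp[n e].
  by exists n.+1; rewrite mulrS -e addrC subrK.
rewrite -/(orthant I) in C1 C2.
case: asboolP => [[zI zpos]|nz]; last first.
  apply/eqP; apply: contra_notT nz => nz; have [n zn] := C2 _ nz.
  rewrite zn; split=> v vI; rewrite restr_Ebase_sum ?(negPf vI) // vI.
  split; first exact: rpred_nat.
  by move: nz; rewrite zn C1 => /prodf_neq0/(_ v vI); rewrite ltr0n; case: (n v).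
have zint v : v \in I -> z v \is a Num.int by case/zpos.
have pos v : v \in I -> 0 < z v by case/zpos.
have zE : z = \sum_(i in I) g i *+ `|Num.floor (z i)|%N.
  apply/ffunP=> v; rewrite restr_Ebase_sum; case: ifPn => [vI|/zI//].
  rewrite -[RHS]/(_%:Z%:~R) gez0_abs ?floorK ?zint //.
  by rewrite floor_ge0 ltW // pos.
rewrite {1}zE C1 big1 // => v vI.
suff -> : (0 < `|Num.floor (z v)|)%N by [].
rewrite absz_gt0 -(intr_eq0 rat) floorK ?zint //.
by rewrite gt_eqF // pos.
Qed.

End Counting.

Lemma int_ge1 (a : rat) : a \is a Num.int -> 0 < a -> 1 <= a.
Proof. by case/intrP=> m ->; rewrite ltr0z ler1z. Qed.

Section BoxSums.
Variables (V : finType) (T : plumbing_tree V) (lh : dual T) (h : H T).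
Hypothesis lh_class : class lh = h.
Hypothesis lh_itv : forall v, 0 <= lh v < 1.
Variables (x : dual T) (B : nat).
(** The contributing points with some coordinate below x lie in a fixed box. *)
Hypothesis box : forall i v, weight lh i != 0 -> point lh i v < x v ->
  forall w, (i w <= B)%N.
Local Open Scope classical_set_scope.

(** The vector of natural numbers underlying an element of the box. *)
Definition nats (i : {ffun V -> 'I_B.+1}) : V -> nat := fun v => i v.

Lemma point_inj (i j : {ffun V -> 'I_B.+1}) :
  point lh (nats i) = point lh (nats j) :> LQ V -> i = j.
Proof.
move=> /ffunP e; apply/ffunP=> v; apply: val_inj.
have := e v; rewrite !pointE => /addrI/eqP.
by rewrite eqr_nat => /eqP.
Qed.

Lemma boxP i v : weight lh i != 0 -> point lh i v < x v ->
  exists j : {ffun V -> 'I_B.+1}, nats j = i.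
Proof.
move=> nz iv; exists [ffun w => inord (i w)]; apply/funext => w.
by rewrite /nats ffunE inordK // ltnS (box nz iv).
Qed.

Lemma Qred_box : Qred h x =
  \sum_(i : {ffun V -> 'I_B.+1} |
       [exists v in nodes T, point lh (nats i) v < x v]) weight lh (nats i).
Proof.
rewrite /Qred (@fsum_image _ _ (fun i => point lh (nats i)) _
  (fun i => [exists v in nodes T, point lh (nats i) v < x v])).
- by apply: eq_bigr => i _; exact: pser_point.
- by move=> i j e; apply: point_inj; rewrite e.
- move=> i /exists_inP[v vN iv]; split; first exact: point_class.
  by exists v.
move=> l /= [lcl [v vN lv]] /(pser_supp lh_class lh_itv lcl)[i li nz].
rewrite li in lv *; have [j jE] := boxP nz lv; rewrite -jE in lv *.
by exists j => //; apply/exists_inP; exists v.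
Qed.

(** A bound on one coordinate in I makes the fibre over z finite. *)
Lemma f_at_box (I : {set V}) (z : LQ V) v : v \in I -> z v < x v ->
  f_at h I z =
  \sum_(i : {ffun V -> 'I_B.+1} | restr I (point lh (nats i)) == z)
     weight lh (nats i).
Proof.
move=> vI zv; rewrite /f_at (@fsum_image _ _ (fun i => point lh (nats i) : LQ V) _
  (fun i => restr I (point lh (nats i)) == z)).
- by apply: eq_bigr => i _; exact: f_point.
- by move=> i j e; exact: point_inj.
- by move=> i /eqP.
move=> l /= lz /(f_supp lh_class lh_itv)[i li nz].
rewrite li in lz *; have iv : point lh i v < x v.
  by move: zv; rewrite -lz ffunE vI.
have [j jE] := boxP nz iv; rewrite -jE in lz *.
by exists j => //; apply/eqP.
Qed.

(** The elements l of class h differ from x + r, where r is the representative of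
h - [x], by integers, so that l_v = x_v + r_v - k for an integer k, and k >= 1
if and only if l_v < x_v. *)
Lemma Coeff_box (I : {set V}) v0 : v0 \in I ->
  Coeff (modified_ser h x I) I x =
  \sum_(i : {ffun V -> 'I_B.+1} | [forall v in I, point lh (nats i) v < x v])
     weight lh (nats i).
Proof.
move=> v0I.
have [lr [lrE lr_class lr_itv]] := r_P (h - class x).
pose rho : LQ V := restr I (- r_ (h - class x)).
have rhoE v : rho v = if v \in I then - lr v else 0.
  by rewrite /rho -lrE ffunE; case: ifP => // _; rewrite ffunE.
have subE (a b : LQ V) v : (a - b) v = a v - b v by rewrite !ffunE.
have addE (a b : LQ V) v : (a + b) v = a v + b v by rewrite !ffunE.
have restrE (a : LQ V) v : restr I a v = if v \in I then a v else 0.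
  by rewrite ffunE.
pose q (i : {ffun V -> 'I_B.+1}) := restr I (point lh (nats i)) + rho.
rewrite /Coeff /modified_ser -/(orthant I) -/rho {1}/smul.
have -> : \sum_(y \in [set: LQ V]) smul (mono rho) (f_at h I) y *
    orthant I (restr I x - y) =
  \sum_(y \in [set: LQ V]) \sum_(i : {ffun V -> 'I_B.+1})
    (if y == q i then weight lh (nats i) * orthant I (restr I x - y) else 0).
  apply: eq_fsbigr => y _; rewrite smul_mono.
  have [o0|] := eqVneq (orthant I (restr I x - y)) 0.
    by rewrite o0 mulr0 big1 // => i _; rewrite mulr0 if_same.
  rewrite orthantE; case: asboolP => [[yI ypos] _|]; last by rewrite eqxx.
  rewrite mulr1 (f_at_box v0I); last first.
    have [/int_ge1 k1 /k1] := ypos v0 v0I.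
    rewrite !subE rhoE !restrE v0I opprK.
    by have /andP[_] := lr_itv v0; lra.
  rewrite big_mkcond; apply: eq_bigr => i _; rewrite mulr1 -subr_eq opprK.
  by rewrite eq_sym.
rewrite (@fsum_fibres _ _ q) => [|i y /negPf-> //].
rewrite [RHS]big_mkcond; apply: eq_bigr => i _; rewrite eqxx orthantE.
have lattice v : x v - point lh (nats i) v + lr v \is a Num.int.
  have /eqP : class (lr + x) = class (point lh (nats i)).
    by rewrite classD lr_class subrK (point_class lh_class).
  move=> /class_diffP /(_ v).
  rewrite -[dual_val (lr + x)]/(val (lr + x)) raddfD /= ffunE.
  by rewrite -addrA addrC.
have coords v : v \in I ->
    (restr I x - q i) v = x v - point lh (nats i) v + lr v.
  by move=> vI; rewrite subE addE rhoE !restrE vI opprD opprK addrA.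
case: asboolP => [[_ pos]|no].
  rewrite mulr1 ifT //; apply/forall_inP => v vI.
  have [_] := pos v vI; rewrite coords // => /(int_ge1 (lattice v)).
  by have /andP[_] := lr_itv v; lra.
rewrite mulr0 ifF //; apply/negP => /forall_inP below; apply: no; split=> v vI.
  by rewrite subE addE rhoE !restrE (negPf vI) ?addr0 ?oppr0 ?addr0.
rewrite coords //; split; first exact: lattice.
by have := below v vI; have /andP[] := lr_itv v; lra.
Qed.
End BoxSums.

(** * Vanishing of the separated sums *)

Section Vanishing.
Variables (V : finType) (T : plumbing_tree V) (lh x : dual T) (B : nat).
Hypothesis lh_lt1 : forall v, lh v < 1.
Hypothesis box : forall i v, weight lh i != 0 -> point lh i v < x v ->
  forall w, (i w <= B)%N.
Hypothesis x_large : forall v, (valency T v)%:R - 1 <= dcoord T x v.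

(** The conditions [phi v] may be imposed on coordinates on both sides of the edge
from u to c.  Being below x at a and at b, on different sides, and not below x
at u make the sum vanish. *)
Lemma separated_sum_eq0 (u c a b : V) (side : pred V) (phi : V -> nat -> bool) :
  adj T u c -> side c -> ~~ side u ->
  (forall v w, adj T v w -> v != u -> v != c -> side w = side v) ->
  side a -> ~~ side b ->
  (forall v l, x v <= lh v + l%:R -> phi v l = (v != a) && (v != b)) ->
  (forall l, ~~ (x u <= lh u + l%:R) -> phi u l = false) ->
  \sum_(i : {ffun V -> 'I_B.+1} | [forall v, phi v (nats i v)])
     weight lh (nats i) = 0.
Proof.
move=> uc sc su sside sa sb phi_good phi_u.
have [par [d [_ adj_par d_par adjP]]] := rooting_exists T u.
have cu : c != u by apply: contraTneq uc => ->; rewrite adj_irr.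
have par_c : par c = u by case/adjP: uc => -[] //; rewrite eqxx.
have val_gt0 v : (0 < valency T v)%N.
  apply/card_gt0P; have [->|vu] := eqVneq v u; first by exists c; rewrite inE.
  by exists (par v); rewrite inE adj_par.
have x_ge0 v : 0 <= x v.
  apply: (@coord_ge0 _ T) => w; apply: le_trans (x_large w).
  by rewrite subr_ge0 ler1n.
pose phiz v l : int := (phi v l)%:R.
pose eps v : int := ((v != a) && (v != b))%:R.
pose F (i : V -> nat) : int := \prod_v (phiz v (i v) *
    binom_coefz ((valency T v)%:Z - 2) (dualc (adj T) (euler T) (cst lh) i v)).
have FE i : F i = (if [forall v, phi v (i v)] then weight lh i else 0).
  rewrite /F big_split /= -/(weight lh i) /phiz; case: ifPn => [/forallP h|].
    by rewrite big1 ?mul1r // => v _; rewrite h.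
  rewrite negb_forall => /existsP[v /negPf nv].
  by rewrite (bigD1 v) //= nv !mul0r.
rewrite big_mkcond /= -(eq_bigr _ (fun i _ => FE (nats i))).
apply: (@weighted_sum_eq0 V (adj T) u c par d side (euler T) (cst lh)
  (fun v => x v) (fun v => lh v) (fun v => Estar T u v) B _ _ cu par_c adj_par
  _ adjP sc su _ _ _ _ _ _ (cstE lh) phiz eps a b) => //.
- exact: adj_sym.
- exact: adj_irr.
- by move=> v /d_par->.
- by move=> v vu vc; apply: sside => //; exact: adj_par.
- by move=> v; exact: Estar_gt0.
- move=> v vu; have := dcoordE T (Estar T u) v.
  by rewrite dcoord_Estar eq_sym (negPf vu) => /esym/eqP; rewrite subr_eq0 => /eqP.
- have := dcoordE T (Estar T u) u; rewrite dcoord_Estar eqxx => e.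
  by rewrite -subr_ge0 -e ler01.
- move=> v; have := x_large v; rewrite dcoordE big_split /= sumr_const.
  rewrite (_ : #|_| = valency T v); last by apply: eq_card => w; rewrite inE.
  lra.
- by move=> v; have := lh_lt1 v; have := x_ge0 v; lra.
- by move=> v l gl; rewrite /phiz phi_good.
- by move=> l bl; rewrite /phiz phi_u.
- by rewrite /eps eqxx.
- by rewrite /eps eqxx andbF.
move=> i; rewrite -/(F i) FE; case: ifP => [/forallP h nz|]; last by rewrite eqxx.
apply: (box nz (v := a)); rewrite pointE ltNge; apply/negP=> ga.
by have := h a; rewrite phi_good // eqxx.
Qed.

End Vanishing.

(** An element satisfying Q exists if and only if there is one of least key, and
then it is unique. *)
Lemma first_indicator (V : finType) (key : V -> nat) (Q : pred V) :
  injective key ->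
  [exists v, Q v]%:R =
  \sum_v (Q v && [forall w, (key w < key v)%N ==> ~~ Q w])%:R :> int.
Proof.
move=> key_inj; case: (boolP [exists v, Q v]) => [/existsP[v0 Qv0]|/existsPn noQ].
  case: (arg_minnP key Qv0) => v Qv vmin.
  have first : [forall w, (key w < key v)%N ==> ~~ Q w].
    by apply/forallP=> w; apply/implyP; rewrite ltnNge; apply: contra; exact: vmin.
  rewrite (bigD1 v) //= Qv first big1 ?addr0 // => w wv.
  case Qw: (Q w) => //=; case: forallP => // /(_ v).
  rewrite Qv implybF -leqNgt => kw; case/eqP: wv; apply: key_inj.
  by apply/eqP; rewrite eqn_leq kw vmin.
by rewrite big1 // => v _; rewrite (negPf (noQ v)).
Qed.

(** * Counting components *)

Section Components.
Variables (V : finType) (N : {set V}) (r : V) (next : V -> V) (key : V -> nat).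
Hypothesis rN : r \in N.
Hypothesis key_inj : injective key.
Hypothesis key_r : forall v, (key r <= key v)%N.
Hypothesis next_N : forall v, next v \in N.
Hypothesis key_next : forall v, v \in N -> v != r -> (key (next v) < key v)%N.

(** The elements of S in N that precede v. *)
Definition before (S : pred V) (v : V) : pred V :=
  fun w => [&& w \in N, (key w < key v)%N & S w].

(** v is in S, its successor towards the root is not, and j is the first element of
S, with j before v. *)
Definition detached (S : pred V) (v j : V) : bool :=
  [&& S v, ~~ S (next v), before S v j &
      [forall w, (key w < key j)%N ==> ~~ before S v w]].

(** For v in S other than r, either the next vertex, which precedes v, is in S, or
it is not but some other element of S precedes v, or v is the first element
of S. *)
Lemma component_count (S : pred V) :
  [exists v in N, S v]%:R =
  \sum_(v in N) (S v)%:R - \sum_(v in N :\ r) (S v && S (next v))%:R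
  - \sum_(v in N :\ r) \sum_j (detached S v j)%:R :> int.
Proof.
rewrite (first_indicator (fun v => (v \in N) && S v) key_inj).
have -> : \sum_v ((v \in N) && S v &&
      [forall w, (key w < key v)%N ==> ~~ ((w \in N) && S w)])%:R =
    \sum_(v in N) (S v && ~~ [exists w, before S v w])%:R :> int.
  rewrite [RHS]big_mkcond; apply: eq_bigr => v _.
  case: (v \in N) => //=; congr (nat_of_bool (_ && _))%:R.
  rewrite negb_exists; apply: eq_forallb => w; rewrite /before.
  by case: (w \in N); case: (key w < key v)%N; case: (S w).
rewrite (bigD1 r) //= [X in X - _ - _](bigD1 r) //=.
have -> : [exists w, before S r w] = false.
  by apply/existsP => -[w /and3P[_]]; rewrite ltnNge key_r.
rewrite andbT -!addrA; congr (_ + _).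
have restrictE (F : V -> int) :
    \sum_(v in N | v != r) F v = \sum_(v in N :\ r) F v.
  by apply: eq_bigl => v; rewrite in_setD1 andbC.
rewrite !restrictE addrA -!sumrB; apply: eq_bigr => v /setD1P[vr vN].
have -> : \sum_j (detached S v j)%:R =
    (S v && ~~ S (next v) && [exists j, before S v j])%:R :> int.
  rewrite /detached; case: (S v) => /=; last by rewrite big1.
  case: (S (next v)) => /=; first by rewrite big1.
  by rewrite (first_indicator (before S v) key_inj).
case: (S v) => //=; case Sn: (S (next v)) => /=.
  suff -> : [exists w, before S v w] by [].
  by apply/existsP; exists (next v); rewrite /before next_N key_next.
by case: [exists w, _].
Qed.

End Components.

Lemma sum_cond (I : finType) (P : pred I) (F : I -> int) :
  \sum_(i | P i) F i = \sum_i F i * (P i)%:R.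
Proof.
by rewrite big_mkcond; apply: eq_bigr => i _; case: (P i); rewrite ?mulr1 ?mulr0.
Qed.

Theorem theorem20 (V : finType) (T : plumbing_tree V) (h : H T) (x s : dual T)
    (hs : int_S' s)
    (hx : x = \sum_(v : V) Estar T v *~ ((valency T v)%:Z - 2) + s) :
  Qred h x =
    \sum_(v in nodes T) Coeff (modified_ser h x [set v]) [set v] x
    - \sum_(e in orb_edges T) Coeff (modified_ser h x e) e x.
Proof.
have [lh [_ lh_class lh_itv]] := r_P h.
have lh_lt1 v : lh v < 1 by case/andP: (lh_itv v).
have [B box] := weight_bounded lh_itv x.
have x_large v : (valency T v)%:R - 1 <= dcoord T x v.
  have [n n_gt0 sE] := hs.
  pose k w : rat := ((valency T w)%:Z - 2)%:~R + (n w)%:R.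
  have valB (a b : dual T) w : (a - b) w = a w - b w.
    by rewrite -[dual_val (a - b)]/(val (a - b)) raddfB !ffunE.
  have val0 w : (0 : dual T) w = 0 by rewrite -(subrr (0 : dual T)) valB subrr.
  have valN (a : dual T) w : (- a) w = - a w by rewrite -sub0r valB val0 sub0r.
  have valD (a b : dual T) w : (a + b) w = a w + b w.
    by rewrite -{1}[b]opprK valB valN opprK.
  have valMn (a : dual T) p w : (a *+ p) w = a w *+ p.
    by elim: p => [|p IHp]; [rewrite !mulr0n val0 | rewrite !mulrS valD IHp].
  have valMz (a : dual T) p w : (a *~ p) w = a w *~ p.
    by case: p => p; rewrite ?NegzE ?mulrNz ?valN valMn.
  have -> : dual_val x = [ffun w => \sum_u k u * (Estar T u : LQ V) w].
    apply/ffunP=> w; rewrite [RHS]ffunE hx sE -big_split.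
    rewrite (big_morph (fun a : dual T => a w) (fun a b => valD a b w) (val0 w)).
    by apply: eq_bigr => u _; rewrite valD valMz valMn mulrDl mulrzl mulr_natl.
  rewrite dcoord_sum (bigD1 v) //= big1 ?addr0 => [|u uv]; last first.
    by rewrite dcoord_Estar (negPf uv) mulr0.
  have := n_gt0 v; rewrite -(ler_nat rat) dcoord_Estar eqxx mulr1 /k intrB.
  by rewrite -[(Posz _)%:~R]/(_%:R); lra.
rewrite (Qred_box lh_class lh_itv box).
have [N0|[r rN]] := set_0Vmem (nodes T).
  have -> : orb_edges T = finset.set0.
    apply/setP=> e; rewrite finset.in_set0; apply/imsetP=> -[[v w]].
    by rewrite inE /orb_adj N0 finset.in_set0.
  rewrite N0 !big_set0 subr0 big1 // => i /exists_inP[v].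
  by rewrite finset.in_set0.
have [par [d root]] := rooting_exists T r.
pose next := next_node root rN.
pose S (i : {ffun V -> 'I_B.+1}) : pred V := fun v => point lh (nats i) v < x v.
(* nodes are ordered by distance to the root, with ties broken arbitrarily *)
pose key v := (d v * #|V| + enum_rank v)%N.
have key_lt v w : (d v < d w)%N -> (key v < key w)%N.
  move=> dvw; apply: (@leq_trans ((d v).+1 * #|V|)).
    by rewrite mulSn [(#|V| + _)%N]addnC /key ltn_add2l ltn_ord.
  by apply: leq_trans (leq_addr _ _); rewrite leq_mul2r dvw orbT.
have key_d v w : (key v < key w)%N -> (d v <= d w)%N.
  by move=> kvw; rewrite leqNgt; apply: contraL kvw => /key_lt; rewrite -leqNgt => /ltnW.
have key_inj : injective key.
  move=> v w kvw; have dvw : d v = d w.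
    by apply/eqP; rewrite eqn_leq; apply/andP; split; rewrite leqNgt;
      apply/negP=> /key_lt; rewrite kvw ltnn.
  by move: kvw; rewrite /key dvw => /addnI/val_inj/enum_rank_inj.
have d_r v : (d r <= d v)%N.
  by apply: (d_anc root); apply/asboolP; exists (d v); exact: (iter_par_root root).
have key_r v : (key r <= key v)%N.
  have [->//|vr] := eqVneq v r; apply/ltnW/key_lt.
  by apply: leq_ltn_trans (d_r _) (d_next_node root rN vr).
have key_next v : v \in nodes T -> v != r -> (key (next v) < key v)%N.
  by move=> _ vr; apply/key_lt/d_next_node.
have detached0 v j : v \in nodes T :\ r ->
    \sum_(i : {ffun V -> 'I_B.+1} | detached (nodes T) next key (S i) v j)
      weight lh (nats i) = 0.
  move=> /setD1P[vr vN].
  have [/andP[jN jv]|njv] := boolP ((j \in nodes T) && (key j < key v)%N); last first.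
    rewrite big_pred0 // => i; apply/negP=> /and4P[_ _ /and3P[jN jv _] _].
    by rewrite jN jv in njv.
  pose good w l := x w <= lh w + l%:R.
  pose phi w l := [&& (w == v) ==> ~~ good w l, (w == next v) ==> good w l,
    (w == j) ==> ~~ good w l &
    ((w \in nodes T) && (key w < key j)%N) ==> good w l].
  have SE i w : S i w = ~~ good w (nats i w) by rewrite /S pointE ltNge.
  rewrite (eq_bigl (fun i => [forall w, phi w (nats i w)])) => [|i]; last first.
    rewrite /detached /before jN jv !SE negbK /=; apply/and4P/forallP.
      move=> [Sv Sn Sj /forallP first] w; apply/and4P.
      split; apply/implyP; do ?[by move/eqP->].
      case/andP=> wN wj; have /implyP/(_ wj) := first w.
      by rewrite wN (ltn_trans wj jv) SE negbK.
    move=> all_phi; split.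
    - by have /and4P[/implyP/(_ (eqxx _))] := all_phi v.
    - by have /and4P[_ /implyP/(_ (eqxx _))] := all_phi (next v).
    - by have /and4P[_ _ /implyP/(_ (eqxx _))] := all_phi j.
    apply/forallP=> w; apply/implyP=> wj; have /and4P[_ _ _] := all_phi w.
    by rewrite wj SE; case: (w \in nodes T) => //= ->; rewrite andbF.
  have [_ adj_par _ adjP] := root.
  have br := branch_neq_root root rN vr.
  apply: (separated_sum_eq0 lh_lt1 box x_large (u := next v)
    (c := branch root rN v) (a := v) (b := j) (side := anc par (branch root rN v))).
  - by rewrite adj_sym -[next v]/(par (branch root rN v)) adj_par.
  - exact: anc_refl.
  - exact: (anc_child root br).
  - move=> a b /adjP[[ar <-]|[b_r <-]] an ab; first exact: anc_par.
    apply/esym/anc_par; apply: contraNneq an => ->; exact: eqxx.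
  - exact: anc_branch.
  - apply/negP=> /(node_below_branch vr jN) vj.
    have e : v = j by apply: (anc_eq root vj); exact: key_d.
    by rewrite e ltnn in jv.
  - move=> w l gw; rewrite /phi /good gw !implybT /= !implybF.
    by rewrite andbT.
  - by move=> l /negPf gu; rewrite /phi eqxx /good gu andbF.
under [X in _ = X - _]eq_bigr do rewrite (Coeff_box lh_class lh_itv box (finset.set11 _)).
rewrite (orb_edgesE root rN) big_imset /=; last exact: orb_edge_inj.
under [X in _ = _ - X]eq_bigr do rewrite (Coeff_box lh_class lh_itv box (finset.set21 _ _)).
rewrite sum_cond.
rewrite (eq_bigr _ (fun i _ => congr1 (fun z => weight lh (nats i) * z)
  (component_count rN key_inj key_r (next_node_in root rN) key_next (S i)))).
have pull (A : {set V}) (P : {ffun V -> 'I_B.+1} -> pred V) :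
    \sum_i weight lh (nats i) * (\sum_(v in A) (P i v)%:R) =
    \sum_(v in A) \sum_(i | P i v) weight lh (nats i).
  under eq_bigr do rewrite mulr_sumr.
  by rewrite exchange_big; apply: eq_bigr => v _; rewrite sum_cond.
under eq_bigr do rewrite !mulrBr.
rewrite !sumrB pull pull -addrA -opprD; congr (_ - _).
  apply: eq_bigr => v _; apply: eq_bigl => i.
  by apply/idP/forall_inP => [Sv w /finset.set1P->|]; last by apply; rewrite finset.set11.
rewrite -[RHS]addr0; congr (_ + _).
  apply: eq_bigr => v _; apply: eq_bigl => i.
  apply/andP/forall_inP => [[Sv Sn] w /finset.set2P[]->//|below].
  by split; apply: below; rewrite ?finset.set21 ?finset.set22.
under eq_bigr do rewrite mulr_sumr.
rewrite exchange_big big1 //= => v vN.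
under eq_bigr do rewrite mulr_sumr.
by rewrite exchange_big big1 //= => j _; rewrite -sum_cond detached0.
Qed.
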